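(* For every $k\ge 1$ there is an equivalence of spectra $\mathbb S^{k,k}\simeq\Sigma^\infty PU(k)_+$, where $PU(k)=U(k)/U(1)$ is the projective unitary group.
   Context: $M_k$ is the $C^*$-algebra of $k\times k$ complex matrices. For a pointed finite CW-complex $X$, $C_0(X,M_l)$ is the $C^*$-algebra of continuous maps $X\to M_l$ sending the basepoint to $0$. $G_{k,l}(X)$ is the space of all (not necessarily unital) $*$-homomorphisms $C_0(X,M_l)\to M_k$ with the topology of pointwise norm convergence, pointed by the zero homomorphism; it is a pointed continuous covariant functor of $X$. $\mathbb S^{k,l}$ is the stabilization of $G_{k,l}$, i.e. the spectrum given by the sequence $G_{k,l}(S^0),G_{k,l}(S^1),\dots$, equivalently $\mathrm{hocolim}_n\Sigma^{-n}\Sigma^\infty G_{k,l}(S^n)$. (It is the mapping spectrum from $\Sigma^\infty_{\mathrm{NC}}M_k$ to $\Sigma^\infty_{\mathrm{NC}}M_l$ in the stable $\infty$-category of noncommutative CW-spectra, so $\mathbb S^{k,k}$ is the endomorphism spectrum of $\Sigma^\infty_{\mathrm{NC}}M_k$.) *)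

(* Defs.v *)
From HB Require Import structures.
From Stdlib Require Import Relations.
From mathcomp Require Import all_boot all_order all_algebra generic_quotient.
From mathcomp Require Import spectral complex.
From mathcomp Require Import all_classical all_reals all_analysis.

Set Implicit Arguments.
Unset Strict Implicit.
Unset Printing Implicit Defensive.

Import Order.TTheory GRing.Theory Num.Theory numFieldNormedType.Exports.

Local Open Scope classical_set_scope.
Local Open Scope ring_scope.
Local Open Scope quotient_scope.
Local Open Scope complex_scope.
Local Open Scope sesquilinear_scope.

Record ptmap (X Y : ptopologicalType) := PtMap {
  ptmap_fun :> X -> Y;
  ptmap_continuous : continuous ptmap_fun;
  ptmap_point : ptmap_fun point = point }.

Section pmap_comp.
Context (X Y Z : ptopologicalType) (g : ptmap Y Z) (f : ptmap X Y).

Lemma pcomp_continuous : continuous (g \o f).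
Proof. by move=> x; apply: continuous_comp; exact: ptmap_continuous. Qed.

Lemma pcomp_point : (g \o f) point = point.
Proof. by rewrite /= !ptmap_point. Qed.

Definition pcomp : ptmap X Z := PtMap pcomp_continuous pcomp_point.
End pmap_comp.

Definition pid (X : ptopologicalType) : ptmap X X :=
  @PtMap X X idfun (fun x => cvg_id) erefl.

Definition homotopic (R : realType) (X Y : ptopologicalType)
    (f g : ptmap X Y) :=
  exists H : X * R -> Y,
    [/\ {within [set: X] `*` `[0, 1]%classic, continuous H},
        forall x, H (x, 0) = f x,
        forall x, H (x, 1) = g x &
        forall t, t \in `[0, 1] -> H (point, t) = point].

Section smash.
Context (X Y : ptopologicalType).

Let in_wedge (a : X * Y) := (a.1 == point) || (a.2 == point).

Let smash_rel (a b : X * Y) := (a == b) || in_wedge a && in_wedge b.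

Local Lemma smash_rel_refl : reflexive smash_rel.
Proof. by move=> a; rewrite /smash_rel eqxx. Qed.

Local Lemma smash_rel_sym : symmetric smash_rel.
Proof. by move=> a b; rewrite /smash_rel eq_sym andbC. Qed.

Local Lemma smash_rel_trans : transitive smash_rel.
Proof.
move=> b a c /predU1P[-> //|/andP[wa wb]] /predU1P[<-|/andP[_ wc]].
  by rewrite /smash_rel wa wb orbT.
by rewrite /smash_rel wa wc orbT.
Qed.

Definition smash_equiv :=
  EquivRel smash_rel smash_rel_refl smash_rel_sym smash_rel_trans.

Definition smash := quotient_topology {eq_quot smash_equiv}.
HB.instance Definition _ := Topological.on smash.
HB.instance Definition _ := Quotient.on smash.
HB.instance Definition _ := isPointed.Build smash (\pi_smash (point, point)).

Definition smash_pair (a : X * Y) : smash := \pi_smash a.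

Lemma smash_pair_continuous : continuous smash_pair.
Proof. exact: (@pi_continuous _ {eq_quot smash_equiv}). Qed.

Lemma smash_pair_surj (z : smash) : exists a, z = smash_pair a.
Proof. by exists (repr z); rewrite /smash_pair reprK. Qed.

Lemma smash_pair_pointl y : smash_pair (point, y) = point.
Proof. by apply/eqmodP/orP; right; rewrite /in_wedge /= !eqxx. Qed.

Lemma smash_pair_pointr x : smash_pair (x, point) = point.
Proof. by apply/eqmodP/orP; right; rewrite /in_wedge /= !eqxx !orbT. Qed.

Section lift.
Context (Z : ptopologicalType) (h : X * Y -> Z).
Hypotheses (hc : continuous h) (hl : forall y, h (point, y) = point)
  (hr : forall x, h (x, point) = point).

Lemma smash_lift_wd : {homo h : a b / \pi_smash a == \pi_smash b >-> a == b}.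
Proof.
have hw a : in_wedge a -> h a = point.
  by case: a => x y /orP[] /= /eqP ->; [exact: hl | exact: hr].
move=> a b /eqP/eqmodP /= /predU1P[-> //|/andP[wa wb]].
by rewrite !hw.
Qed.

Lemma smash_lift_pair a : (h \o repr) (smash_pair a) = h a.
Proof. by apply/eqP/smash_lift_wd; rewrite reprK. Qed.

Lemma smash_lift_continuous : continuous (h \o (repr : smash -> X * Y)).
Proof.
exact: (@repr_comp_continuous _ {eq_quot smash_equiv} _ _ hc smash_lift_wd).
Qed.

Lemma smash_lift_point : (h \o (repr : smash -> X * Y)) point = point.
Proof. by rewrite smash_lift_pair hl. Qed.

Definition smash_lift : ptmap smash Z :=
  PtMap smash_lift_continuous smash_lift_point.
End lift.
End smash.

Section smash_map.
Context (X X' Y Y' : ptopologicalType) (f : ptmap X X') (g : ptmap Y Y').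

Let h (a : X * Y) : smash X' Y' := smash_pair (f a.1, g a.2).

Local Lemma smash_map_continuous : continuous h.
Proof.
move=> a; apply: continuous_comp; last exact: smash_pair_continuous.
apply: cvg_pair => /=.
- by apply: continuous_comp; [exact: cvg_fst | exact: ptmap_continuous].
- by apply: continuous_comp; [exact: cvg_snd | exact: ptmap_continuous].
Qed.

Local Lemma smash_map_pointl y : h (point, y) = point.
Proof. by rewrite /h /= ptmap_point smash_pair_pointl. Qed.

Local Lemma smash_map_pointr x : h (x, point) = point.
Proof. by rewrite /h /= ptmap_point smash_pair_pointr. Qed.

Definition smash_map : ptmap (smash X Y) (smash X' Y') :=
  smash_lift smash_map_continuous smash_map_pointl smash_map_pointr.
End smash_map.

Section add_point.
Context (X : topologicalType).

Definition add_point := option X.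
HB.instance Definition _ := Choice.on add_point.

Let add_point_open (U : set add_point) := open (Some @^-1` U).

Local Lemma add_point_openT : add_point_open setT.
Proof. exact: openT. Qed.

Local Lemma add_point_openI U V :
  add_point_open U -> add_point_open V -> add_point_open (U `&` V).
Proof. exact: openI. Qed.

Local Lemma add_point_open_bigU (I : Type) (f : I -> set add_point) :
  (forall i, add_point_open (f i)) -> add_point_open (\bigcup_i f i).
Proof.
move=> fo; rewrite /add_point_open preimage_bigcup.
by apply: bigcup_open => i _; exact: fo.
Qed.

HB.instance Definition _ := isOpenTopological.Build add_point
  add_point_openT add_point_openI add_point_open_bigU.
HB.instance Definition _ := isPointed.Build add_point None.
End add_point.

Section circle.
Context (R : realType).

Definition unit_circle : set (R * R) := [set v | v.1 ^+ 2 + v.2 ^+ 2 = 1].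

Definition circle := set_type unit_circle.
HB.instance Definition _ := Topological.on circle.

Lemma circle_point : (1, 0) \in unit_circle.
Proof. by apply/mem_set; rewrite /unit_circle /= expr1n expr2 mulr0 addr0. Qed.

HB.instance Definition _ := isPointed.Build circle
  (exist (fun v => v \in unit_circle) _ circle_point).
End circle.

Definition susp (R : realType) (X : ptopologicalType) : ptopologicalType :=
  smash X (circle R).

Definition susp_map (R : realType) (X Y : ptopologicalType) (f : ptmap X Y) :
  ptmap (susp R X) (susp R Y) := smash_map f (pid _).

(** [S^0] is [bool], which is discrete with base point [false]. *)
Definition sphere (R : realType) (n : nat) : ptopologicalType :=
  iter n (susp R) bool.

Record spectrum (R : realType) := Spectrum {
  level :> nat -> ptopologicalType;
  bond : forall n, ptmap (susp R (level n)) (level n.+1) }.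

Record spectrum_map (R : realType) (E F : spectrum R) := SpectrumMap {
  map_level :> forall n, ptmap (E n) (F n);
  map_bond : forall n z,
    map_level n.+1 (bond E n z) = bond F n (susp_map R (map_level n) z) }.

Definition suspension_spectrum (R : realType) (X : ptopologicalType) :
  spectrum R := @Spectrum R (fun n => iter n (susp R) X) (fun n => pid _).

(** The stable homotopy group [pi_m E], the colimit over [q] of the sets of
    homotopy classes of pointed maps [S^(m + q) -> E q].  It is a mere set here:
    the maps between these groups induced by maps of spectra are homomorphisms,
    so their being isomorphisms amounts to their being bijective. *)
Section stable_homotopy.
Context (R : realType) (E : spectrum R) (m : int).

Record germ := Germ {
  germ_dim : nat;
  germ_lvl : nat;
  germ_degree : germ_dim%:Z = m + germ_lvl%:Z;
  germ_map : ptmap (sphere R germ_dim) (E germ_lvl) }.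
HB.instance Definition _ := gen_eqMixin germ.
HB.instance Definition _ := gen_choiceMixin germ.

Lemma germ_degreeS p q : p%:Z = m + q%:Z -> p.+1%:Z = m + q.+1%:Z.
Proof. by move=> pq; rewrite !intS pq addrCA. Qed.

Inductive germ_step : germ -> germ -> Prop :=
| germ_homotopic p q (e : p%:Z = m + q%:Z) (f g : ptmap (sphere R p) (E q)) :
    homotopic R f g -> germ_step (Germ e f) (Germ e g)
| germ_susp p q (e : p%:Z = m + q%:Z) (f : ptmap (sphere R p) (E q)) :
    germ_step (Germ e f)
      (@Germ p.+1 q.+1 (germ_degreeS e) (pcomp (bond E q) (susp_map R f))).

Definition germ_eq (x y : germ) : bool :=
  `[< clos_refl_sym_trans germ germ_step x y >].

Local Lemma germ_eq_refl : reflexive germ_eq.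
Proof. by move=> x; apply/asboolP; exact: rst_refl. Qed.

Local Lemma germ_eq_sym : symmetric germ_eq.
Proof. by move=> x y; apply/asboolP/asboolP; exact: rst_sym. Qed.

Local Lemma germ_eq_trans : transitive germ_eq.
Proof.
by move=> y x z /asboolP xy /asboolP yz; apply/asboolP; exact: rst_trans yz.
Qed.

Definition germ_equiv :=
  EquivRel germ_eq germ_eq_refl germ_eq_sym germ_eq_trans.

Definition stable_pi := {eq_quot germ_equiv}.
End stable_homotopy.

Definition map_germ (R : realType) (E F : spectrum R) (f : spectrum_map E F)
    (m : int) (x : germ E m) : germ F m :=
  Germ (germ_degree x) (pcomp (f (germ_lvl x)) (germ_map x)).

(** This does not depend on the representatives, since [map_germ f] preserves
    [germ_step]. *)
Definition map_pi (R : realType) (E F : spectrum R) (f : spectrum_map E F)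
    (m : int) (x : stable_pi E m) : stable_pi F m :=
  \pi_(stable_pi F m) (map_germ f (repr x)).

Definition stable_equivalence (R : realType) (E F : spectrum R)
  (f : spectrum_map E F) := forall m : int, bijective (map_pi f (m := m)).

(** Isomorphism in the stable homotopy category, which is the localization of
    sequential spectra at the stable equivalences: two spectra are isomorphic
    there if and only if a zigzag of stable equivalences joins them. *)
Definition spectrum_equivalent (R : realType) : relation (spectrum R) :=
  clos_refl_sym_trans (spectrum R)
    (fun E F => exists f : spectrum_map E F, stable_equivalence f).

Section mx_continuity.
Context (C : numClosedFieldType) (X : topologicalType).

Lemma mx_continuousP m n (f : X -> 'M[C]_(m, n)) :
  continuous f <-> forall i j, continuous (fun x => f x i j).
Proof.
split=> [fc i j x|fc x A].
  by apply: (@continuous_comp _ _ _ f (fun M : 'M[C]_(m, n) => M i j) x);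
    [exact: fc | exact: coord_continuous].
move=> [P nP PA]; apply: (filterS (P := fun y => forall i j, P i j (f y i j))).
  by move=> y Py; apply: PA.
by apply: filter_forall => i; apply: filter_forall => j; exact: fc (nP i j).
Qed.

Lemma sum_continuous (I : Type) (r : seq I) (P : pred I) (F : I -> X -> C) :
  (forall i, continuous (F i)) ->
  continuous (fun x => \sum_(i <- r | P i) F i x).
Proof.
move=> Fc x; elim: r => [|i r IHr].
  by under eq_fun do rewrite big_nil; exact: cvg_cst.
under eq_fun do rewrite big_cons.
by case: (P i) => //; apply: cvgD => //; exact: Fc.
Qed.

Lemma prod_continuous (I : Type) (r : seq I) (P : pred I) (F : I -> X -> C) :
  (forall i, continuous (F i)) ->
  continuous (fun x => \prod_(i <- r | P i) F i x).
Proof.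
move=> Fc x; elim: r => [|i r IHr].
  by under eq_fun do rewrite big_nil; exact: cvg_cst.
under eq_fun do rewrite big_cons.
by case: (P i) => //; apply: cvgM => //; exact: Fc.
Qed.

Lemma mulmx_continuous m n p (f : X -> 'M[C]_(m, n)) (g : X -> 'M[C]_(n, p)) :
  continuous f -> continuous g -> continuous (fun x => f x *m g x).
Proof.
move=> /mx_continuousP fc /mx_continuousP gc; apply/mx_continuousP => i j.
under eq_fun do rewrite mxE.
by apply: sum_continuous => k x; apply: cvgM; [exact: fc | exact: gc].
Qed.

Lemma adjmx_continuous m n (f : X -> 'M[C]_(m, n)) :
  continuous f -> continuous (fun x => (f x) ^t*).
Proof.
move=> /mx_continuousP fc; apply/mx_continuousP => i j.
under eq_fun do rewrite !mxE.
move=> x; apply/cvgrPdist_lt => e e0.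
move/cvgrPdist_lt : (fc j i x) => /(_ e e0).
by apply: filterS => y; rewrite -rmorphB norm_conjC.
Qed.

Lemma det_continuous n (f : X -> 'M[C]_n) :
  continuous f -> continuous (fun x => \det (f x)).
Proof.
move=> /mx_continuousP fc; apply: sum_continuous => s x.
by apply: cvgM; [exact: cvg_cst | apply: prod_continuous => i; exact: fc].
Qed.

Lemma invmx_continuous n (f : X -> 'M[C]_n) :
  (forall x, f x \in unitmx) -> continuous f ->
  continuous (fun x => invmx (f x)).
Proof.
move=> fU fc; apply/mx_continuousP => i j.
under eq_fun do rewrite /invmx fU !mxE.
move=> x; apply: cvgM.
  apply: cvgV; last exact: det_continuous.
  by have := fU x; rewrite unitmxE unitfE.
apply: cvgM; first exact: cvg_cst.
apply: det_continuous; apply/mx_continuousP => i' j' y.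
by under eq_fun do rewrite !mxE; move/mx_continuousP : fc; apply.
Qed.
End mx_continuity.

(** Packing [R[i]] as a [numClosedFieldType] is what makes the norm topology
    available on it. *)
Definition cplx (R : realType) : numClosedFieldType := R[i].

Section C0.
Context (R : realType) (X : ptopologicalType) (l : nat).
Local Notation C := (cplx R).

Definition C0_pred : {pred X -> 'M[C]_l} :=
  [pred f : X -> 'M[C]_l | `[< continuous f /\ f point = 0 >]].

Lemma C0_predP (f : X -> 'M[C]_l) :
  reflect (continuous f /\ f point = 0) (f \in C0_pred).
Proof. exact: asboolP. Qed.

Record C0 := MkC0 { C0_fun :> X -> 'M[C]_l; C0_funP : C0_fun \in C0_pred }.
HB.instance Definition _ := [isSub for C0_fun].
HB.instance Definition _ := [Choice of C0 by <:].

Lemma C0_continuous (f : C0) : continuous f.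
Proof. by case: f => f /= /C0_predP[]. Qed.

Lemma C0_point (f : C0) : f point = 0.
Proof. by case: f => f /= /C0_predP[]. Qed.

Lemma C0_submod_closed : submod_closed C0_pred.
Proof.
split; first by apply/C0_predP; split=> // x; exact: cvg_cst.
move=> a f g /C0_predP[fc f0] /C0_predP[gc g0]; apply/C0_predP; split.
  by move=> x; apply: cvgD; [apply: cvgZr; exact: fc | exact: gc].
by rewrite !fctE f0 g0 scaler0 addr0.
Qed.
HB.instance Definition _ :=
  GRing.isSubmodClosed.Build C (X -> 'M[C]_l) C0_pred C0_submod_closed.
HB.instance Definition _ := [SubChoice_isSubLmodule of C0 by <:].

Lemma C0_mul_subproof (f g : C0) : (fun x => f x *m g x) \in C0_pred.
Proof.
apply/C0_predP; split; last by rewrite C0_point mul0mx.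
by apply: mulmx_continuous; exact: C0_continuous.
Qed.

Definition C0_mul (f g : C0) : C0 := MkC0 (C0_mul_subproof f g).

Lemma C0_star_subproof (f : C0) : (fun x => (f x) ^t*) \in C0_pred.
Proof.
apply/C0_predP; split; last by rewrite C0_point trmx0 map_mx0.
by apply: adjmx_continuous; exact: C0_continuous.
Qed.

Definition C0_star (f : C0) : C0 := MkC0 (C0_star_subproof f).
End C0.

Section C0_comp.
Context (R : realType) (X Y : ptopologicalType) (l : nat) (h : ptmap X Y).

Lemma C0_comp_subproof (f : C0 R Y l) : f \o h \in @C0_pred R X l.
Proof.
apply/C0_predP; split; last by rewrite /= ptmap_point C0_point.
move=> x; apply: continuous_comp; first exact: ptmap_continuous.
exact: C0_continuous.
Qed.

Definition C0_comp (f : C0 R Y l) : C0 R X l := MkC0 (C0_comp_subproof f).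
End C0_comp.

Section star_hom.
Context (R : realType) (k l : nat) (X : ptopologicalType).
Local Notation C := (cplx R).

(** The topology on [Gkl] below is the one of pointwise norm convergence: the
    topology of ['M[C]_k] is entrywise convergence, i.e. that of any norm. *)
Definition star_hom : set {ptws C0 R X l -> 'M[C]_k} :=
  [set phi | [/\ linear (phi : C0 R X l -> 'M[C]_k),
    forall f g, phi (C0_mul f g) = phi f *m phi g &
    forall f, phi (C0_star f) = (phi f) ^t*]].

Definition Gkl := set_type star_hom.
HB.instance Definition _ := Topological.on Gkl.

Definition G_fun (phi : Gkl) : C0 R X l -> 'M[C]_k := \val phi.

Lemma G_funP (phi : Gkl) : star_hom (G_fun phi).
Proof. exact: set_valP. Qed.

Definition MkG (phi : C0 R X l -> 'M[C]_k) (phiP : star_hom phi) : Gkl :=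
  exist (fun phi => phi \in star_hom) phi (mem_set phiP).

Lemma star_hom0 : star_hom (fun=> 0).
Proof.
split=> [a f g|f g|f]; first by rewrite scaler0 addr0.
- by rewrite mul0mx.
- by rewrite trmx0 map_mx0.
Qed.

HB.instance Definition _ := isPointed.Build Gkl (MkG star_hom0).

Lemma G_fun_inj (phi psi : Gkl) : G_fun phi = G_fun psi -> phi = psi.
Proof. exact: val_inj. Qed.

Lemma G_linear (phi : Gkl) a (f g : C0 R X l) :
  G_fun phi (a *: f + g) = a *: G_fun phi f + G_fun phi g.
Proof. by have [/(_ a f g)] := G_funP phi. Qed.

Lemma G_mul (phi : Gkl) f g :
  G_fun phi (C0_mul f g) = G_fun phi f *m G_fun phi g.
Proof. by have [_ /(_ f g)] := G_funP phi. Qed.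

Lemma G_star (phi : Gkl) f : G_fun phi (C0_star f) = (G_fun phi f) ^t*.
Proof. by have [_ _ /(_ f)] := G_funP phi. Qed.

Lemma G_fun0 (phi : Gkl) : G_fun phi 0 = 0.
Proof.
have /eqP := G_linear phi 1 0 0.
by rewrite !scale1r addr0 -subr_eq0 opprD addNKr oppr_eq0 => /eqP.
Qed.

Lemma G_funD (phi : Gkl) f g : G_fun phi (f + g) = G_fun phi f + G_fun phi g.
Proof. by rewrite -[f in LHS]scale1r G_linear scale1r. Qed.

Lemma G_funZ (phi : Gkl) a f : G_fun phi (a *: f) = a *: G_fun phi f.
Proof. by rewrite -[a *: f]addr0 G_linear G_fun0 addr0. Qed.

Lemma G_eval_continuous (f : C0 R X l) :
  continuous (fun phi : Gkl => G_fun phi f).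
Proof.
move=> phi; apply: (@continuous_comp _ _ _ (fun phi : Gkl => \val phi)
  (fun psi : {ptws C0 R X l -> 'M[C]_k} => psi f)).
  exact: initial_continuous.
exact: (@proj_continuous _ (fun _ : C0 R X l => 'M[C]_k) f).
Qed.

Lemma G_continuous (T : topologicalType) (F : T -> Gkl) :
  (forall f, continuous (fun t => G_fun (F t) f)) -> continuous F.
Proof.
move=> Fc; apply: continuous_comp_initial => t.
apply/cvg_sup => f U [_ [[W oW <-]] Wt WU].
apply: (filterS WU); exact: Fc (open_nbhs_nbhs (conj oW Wt)).
Qed.
End star_hom.

(** A *-homomorphism is norm-decreasing up to a constant depending only on the
    sizes of the matrices; this makes the assembly map jointly continuous. *)
Section star_hom_bound.
Context (R : realType) (k l : nat) (X : ptopologicalType).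
Local Notation C := (cplx R).

Lemma diag_dominant_unitmx (a : 'M[C]_l) (q : C) :
  q * l%:R < 1 -> (forall i j, `|a i j| <= q) -> 1%:M - a \in unitmx.
Proof.
move=> ql1 aq; rewrite -row_free_unit; apply: inj_row_free => v.
rewrite mulmxBr mulmx1 => /eqP; rewrite subr_eq0 => /eqP va.
pose S : C := \sum_j `|v 0 j|.
have S_le : S <= S * (q * l%:R).
  have step j : `|v 0 j| <= S * q.
    rewrite [in leLHS]va mxE (le_trans (ler_norm_sum _ _ _))// mulr_suml.
    by apply: ler_sum => i _; rewrite normrM ler_wpM2l.
  apply: (@le_trans _ _ (\sum_(j < l) S * q)).
    by apply: ler_sum => j _; exact: step.
  by rewrite sumr_const card_ord -[leLHS]mulr_natr -mulrA.
have S_ge0 : 0 <= S by apply: sumr_ge0.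
have S0 : S = 0.
  apply/eqP; rewrite -[_ == _]negbK; apply/negP => Sn0.
  have S_gt0 : 0 < S by rewrite lt_def Sn0.
  move: S_le; rewrite -[leLHS]mulr1 ler_pM2l// => /(lt_le_trans ql1).
  by rewrite ltxx.
apply/rowP => j; rewrite mxE; apply/eqP; rewrite -normr_eq0.
by move/eqP: S0; rewrite psumr_eq0// => /allP/(_ j (mem_index_enum j)).
Qed.

Lemma C0_quasi_inverse (a : C0 R X l) (q : C) :
  q * l%:R < 1 -> (forall x i j, `|a x i j| <= q) ->
  exists b : C0 R X l, C0_mul a b = a + b.
Proof.
move=> ql1 aq.
have aU x : 1%:M - a x \in unitmx by exact: diag_dominant_unitmx ql1 (aq x).
have bP : (fun x => 1%:M - invmx (1%:M - a x)) \in @C0_pred R X l.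
  apply/C0_predP; split; last by rewrite C0_point subr0 invmx1 subrr.
  move=> x; apply: cvgB; first exact: cvg_cst.
  apply: (@invmx_continuous _ _ _ (fun x => 1%:M - a x)) => // y.
  apply: cvgB; first exact: cvg_cst.
  exact: C0_continuous.
exists (MkC0 bP); apply/val_inj/funext => x /=.
have /(congr1 (fun M => M - invmx (1%:M - a x))) := mulmxV (aU x).
rewrite mulmxBl mul1mx mulmxBr mulmx1 addrAC subrr sub0r => h.
by rewrite h.
Qed.

Lemma G_resolvent (phi : Gkl R k l X) (a : C0 R X l) (q : C) :
  q * l%:R < 1 -> (forall x i j, `|a x i j| <= q) ->
  1%:M - G_fun phi a \in unitmx.
Proof.
move=> ql1 aq; have [b ab] := C0_quasi_inverse ql1 aq.
have pab : G_fun phi a *m G_fun phi b = G_fun phi a + G_fun phi b.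
  by rewrite -G_mul ab G_funD.
have /mulmx1_unit[] // : (1%:M - G_fun phi a) *m (1%:M - G_fun phi b) = 1%:M.
rewrite mulmxBl mul1mx mulmxBr mulmx1 pab.
have -> : G_fun phi a - (G_fun phi a + G_fun phi b) = - G_fun phi b.
  by rewrite opprD addrA subrr sub0r.
by rewrite opprK subrK.
Qed.

Lemma G_bound (phi : Gkl R k l X) (f : C0 R X l) (d : C) : 0 <= d ->
  (forall x i j, `|f x i j| <= d) ->
  forall i j, `|G_fun phi f i j| <= k%:R * l%:R * d.
Proof.
move=> d0 fd i j.
pose A := G_fun phi f; pose H := A *m A ^t*.
have Hherm : H \is hermsymmx.
  apply/is_hermitianmxP; rewrite expr0 scale1r /H.
  by rewrite trmx_mul map_mxM trmxCK.
have /orthomx_spectralP HE := hermitian_normalmx Hherm.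
set P := spectralmx H in HE; set D := spectral_diag H in HE.
have PU : P \in unitmx by exact: spectral_unit.
pose c : C := (l%:R * d) ^+ 2.
have c_ge0 : 0 <= c by rewrite exprn_ge0// mulr_ge0.
have Dreal m : D 0 m \is Num.real.
  by have /mxOverP := hermitian_spectral_diag_real Hherm; apply.
have D_le m : D 0 m <= c.
  rewrite real_leNgt// ?ger0_real//; apply/negP => cD.
  have D_gt0 : 0 < D 0 m by exact: le_lt_trans cD.
  have D_neq0 : D 0 m != 0 by rewrite gt_eqF.
  pose a := (D 0 m)^-1 *: C0_mul f (C0_star f).
  have aq x i' j' : `|a x i' j'| <= (D 0 m)^-1 * (l%:R * d ^+ 2).
    rewrite /a mxE normrM gtr0_norm ?invr_gt0// ler_pM2l ?invr_gt0// mxE.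
    rewrite (le_trans (ler_norm_sum _ _ _))//.
    apply: (@le_trans _ _ (\sum_(i < l) d ^+ 2)); last first.
      by rewrite sumr_const card_ord mulr_natl.
    apply: ler_sum => m' _; rewrite normrM !mxE norm_conjC expr2.
    by apply: ler_pM => //; exact: fd.
  have ql1 : (D 0 m)^-1 * (l%:R * d ^+ 2) * l%:R < 1.
    rewrite -mulrA ltr_pdivrMl// mulr1 (le_lt_trans _ cD)//.
    by rewrite /c exprMn expr2 mulrAC.
  have := G_resolvent phi ql1 aq.
  rewrite G_funZ G_mul G_star -/A -/H HE.
  have -> : 1%:M - (D 0 m)^-1 *: (invmx P *m diag_mx D *m P) =
      invmx P *m diag_mx (const_mx 1 - (D 0 m)^-1 *: D) *m P.
    rewrite [diag_mx (_ - _)](_ : _ = 1%:M - (D 0 m)^-1 *: diag_mx D);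
      last first.
      by rewrite raddfB /= diag_const_mx linearZ.
    rewrite mulmxBr mulmxBl mulmx1.
    by rewrite mulVmx// -scalemxAr -scalemxAl.
  rewrite !unitmx_mul => /andP[/andP[_]] + _.
  rewrite unitmxE det_diag unitfE => /negP; apply.
  by rewrite (bigD1 m)//= !mxE mulVf ?D_neq0// subrr mul0r.
have trH : \tr H = \sum_m D 0 m.
  by rewrite HE mxtrace_mulC mulmxA mulmxV// mul1mx mxtrace_diag.
have trHA : \tr H = \sum_i \sum_j `|A i j| ^+ 2.
  apply: eq_bigr => i' _; rewrite mxE; apply: eq_bigr => j' _.
  by rewrite !mxE normCK.
have Aij : `|A i j| ^+ 2 <= k%:R * c.
  apply: (@le_trans _ _ (\tr H)).
    rewrite trHA (bigD1 i)//= (bigD1 j)//= -addrA lerDl addr_ge0//.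
      by apply: sumr_ge0 => ? _; rewrite exprn_ge0.
    by do 2! apply: sumr_ge0 => ? _; rewrite exprn_ge0.
  rewrite trH; apply: (@le_trans _ _ (\sum_(m < k) c)).
    by apply: ler_sum => m _; exact: D_le.
  by rewrite sumr_const card_ord mulr_natl.
rewrite -(@ler_pXn2r _ 2)// ?nnegrE ?mulr_ge0//.
apply: (le_trans Aij); rewrite -mulrA exprMn -/c ler_wpM2r//.
by rewrite expr2 ler_peMl// ler1n (leq_ltn_trans _ (ltn_ord i)).
Qed.
End star_hom_bound.

Section G_map.
Context (R : realType) (k l : nat) (X Y : ptopologicalType) (h : ptmap X Y).

Lemma G_map_subproof (phi : Gkl R k l X) :
  star_hom (fun f : C0 R Y l => G_fun phi (C0_comp h f)).
Proof.
split=> [a f g|f g|f].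
- by rewrite -G_linear; congr G_fun; exact/val_inj.
- by rewrite -G_mul; congr G_fun; exact/val_inj.
- by rewrite -G_star; congr G_fun; exact/val_inj.
Qed.

Let G_map_fun (phi : Gkl R k l X) : Gkl R k l Y := MkG (G_map_subproof phi).

Local Lemma G_map_continuous : continuous G_map_fun.
Proof. by apply: G_continuous => f; exact: G_eval_continuous. Qed.

Local Lemma G_map_point : G_map_fun point = point.
Proof. exact: G_fun_inj. Qed.

Definition G_map : ptmap (Gkl R k l X) (Gkl R k l Y) :=
  PtMap G_map_continuous G_map_point.
End G_map.

(** The assembly map [G X /\ Y -> G (X /\ Y)] of the pointed continuous functor
    [G = Gkl R k l] takes [phi /\ y] to the image of [phi] under the map
    [x |-> x /\ y]. *)
Section assembly.
Context (R : realType) (k l : nat) (X Y : ptopologicalType).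
Local Notation C := (cplx R).

Section smash_pairl.
Context (y : Y).

Let h (x : X) := smash_pair (x, y).

Local Lemma smash_pairl_continuous : continuous h.
Proof.
move=> x; apply: continuous_comp; last exact: smash_pair_continuous.
by apply: cvg_pair => /=; [exact: cvg_id | exact: cvg_cst].
Qed.

Definition smash_pairl : ptmap X (smash X Y) :=
  PtMap smash_pairl_continuous (@smash_pair_pointl X Y y).
End smash_pairl.

Let h (a : Gkl R k l X * Y) : Gkl R k l (smash X Y) :=
  G_map R k l (smash_pairl a.2) a.1.

Hypothesis cX : compact [set: X].

Lemma C0_comp_near (f : C0 R (smash X Y) l) (y0 : Y) (d : C) : 0 < d ->
  \forall y \near y0, forall x i j,
    `|(C0_comp (smash_pairl y0) f - C0_comp (smash_pairl y) f) x i j| <= d.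
Proof.
move=> d0.
have /compact_near_coveringP cov := cX.
pose P y x := forall i j,
  `|(C0_comp (smash_pairl y0) f - C0_comp (smash_pairl y) f) x i j| <= d.
have H : \forall y \near y0, [set: X] `<=` P y.
  apply: cov => x _.
  pose Q i j (a : X * Y) : Prop :=
    `|(C0_comp (smash_pairl y0) f - C0_comp (smash_pairl a.2) f) a.1 i j| <= d.
  suff QQ i j : nbhs (x, y0) (Q i j).
    have FF : Filter (nbhs (x, y0)) := nbhs_filter _.
    have QF i := @filter_forall _ _ _ _ FF (QQ i).
    by have := @filter_forall _ _ _ _ FF QF.
  pose D (a : X * Y) : C :=
    f (smash_pair (a.1, y0)) i j - f (smash_pair a) i j.
  have Dc : continuous D.
    have /mx_continuousP fc := @C0_continuous _ _ _ f.
    move=> a; apply: cvgB.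
      apply: (@continuous_comp _ _ _ (fun a : X * Y => smash_pair (a.1, y0))
        (fun z => f z i j)); last exact: fc.
      apply: continuous_comp; last exact: smash_pair_continuous.
      by apply: cvg_pair => /=; [exact: cvg_fst | exact: cvg_cst].
    apply: (@continuous_comp _ _ _ (@smash_pair X Y) (fun z => f z i j)).
      exact: smash_pair_continuous.
    exact: fc.
  have /cvgrPdist_le/(_ d d0) := Dc (x, y0).
  apply: filterS => -[x' y'] /=.
  by rewrite {1}/D /= subrr sub0r normrN /Q /D /= !mxE.
by apply: filterS H => y Py x; exact: Py.
Qed.

Local Lemma assembly_continuous : continuous h.
Proof.
apply: G_continuous => f; apply/mx_continuousP => i j [phi0 y0].
rewrite /h /=; apply/cvgrPdist_lt => e e0.
pose f0 := C0_comp (smash_pairl y0) f.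
have N_gt0 : 0 < k%:R * l%:R + 1 :> C by rewrite ltr_wpDl// mulr_ge0.
pose d : C := e / 2 / (k%:R * l%:R + 1).
have d_gt0 : 0 < d by rewrite !divr_gt0.
have kld : k%:R * l%:R * d < e / 2.
  by rewrite /d mulrA ltr_pdivrMr// mulrC ltr_pM2l ?divr_gt0// ltrDl.
have phi_near : \forall phi \near phi0,
    `|G_fun phi0 f0 i j - G_fun phi f0 i j| < e / 2.
  have /mx_continuousP/(_ i j phi0) := @G_eval_continuous R k l X f0.
  by move=> /cvgrPdist_lt; apply; rewrite divr_gt0.
have y_near := C0_comp_near f y0 d_gt0.
exists ([set phi | `|G_fun phi0 f0 i j - G_fun phi f0 i j| < e / 2],
  [set y | forall x i j,
    `|(f0 - C0_comp (smash_pairl y) f) x i j| <= d]) => //.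
move=> [phi y] /= [phiP yP].
have := @G_bound R k l X phi (f0 - C0_comp (smash_pairl y) f) d
  (ltW d_gt0) yP i j => /le_lt_trans/(_ kld).
rewrite -[f0 - _]addrC -scaleN1r G_linear scaleN1r addrC !mxE => b.
rewrite [e]splitr -[X in `|X|](subrKA (G_fun phi f0 i j)).
exact: (le_lt_trans (ler_normD _ _) (ltrD phiP b)).
Qed.

Local Lemma assembly_pointl y : h (point, y) = point.
Proof. exact: ptmap_point. Qed.

Local Lemma assembly_pointr phi : h (phi, point) = point.
Proof.
apply: G_fun_inj; apply/funext => f.
change (G_fun phi (C0_comp (smash_pairl point) f) = 0).
rewrite [C0_comp _ f](_ : _ = 0) ?G_fun0//; apply/val_inj/funext => x /=.
by rewrite smash_pair_pointr C0_point.
Qed.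

Definition assembly : ptmap (smash (Gkl R k l X) Y) (Gkl R k l (smash X Y)) :=
  smash_lift assembly_continuous assembly_pointl assembly_pointr.
End assembly.

Section sphere_compact.
Context (R : realType).

Lemma smash_compact (X Y : ptopologicalType) :
  compact [set: X] -> compact [set: Y] -> compact [set: smash X Y].
Proof.
move=> cX cY; have cXY := compact_setX cX cY.
have -> : [set: smash X Y] = @smash_pair X Y @` ([set: X] `*` [set: Y]).
  apply/seteqP; split=> // z _; have [a ->] := smash_pair_surj z.
  by exists a.
apply: continuous_compact => //; apply: continuous_subspaceT.
exact: smash_pair_continuous.
Qed.

Lemma unit_circle_compact : compact (@unit_circle R).
Proof.
pose I : set R := `[-1, 1]%classic.
have cI : compact I by exact: segment_compact.
apply: subclosed_compact (compact_setX cI cI) _.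
- rewrite (_ : @unit_circle R =
    (fun v : R * R => v.1 ^+ 2 + v.2 ^+ 2) @^-1` [set 1]) //.
  apply: preimage_closed; last exact: closed_eq.
  move=> v _; apply: cvgD; rewrite expr2.
    by under eq_fun do rewrite expr2; apply: cvgM; exact: cvg_fst.
  by under eq_fun do rewrite expr2; apply: cvgM; exact: cvg_snd.
- have sqr_le1 (x : R) : x ^+ 2 <= 1 -> I x.
    rewrite /I /= in_itv /= -ler_norml -real_normK ?num_real//.
    by rewrite expr_le1.
  by move=> [x y] /=; rewrite /unit_circle /= => xy;
    split; apply: sqr_le1; rewrite -xy ?lerDl ?lerDr sqr_ge0.
Qed.

Lemma circle_compact : compact [set: circle R].
Proof.
pose f (v : R * R) : circle R := insubd (point : circle R) v.
have fK (c : circle R) : f (\val c) = c by rewrite /f valKd.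
have -> : [set: circle R] = f @` @unit_circle R.
  by apply/seteqP; split=> // c _; exists (\val c) => //; exact: set_valP.
apply: continuous_compact; last exact: unit_circle_compact.
apply/subspace_sigL_continuousP.
rewrite [sigL _ _](_ : _ = id); last exact/funext.
by move=> x; exact: cvg_id.
Qed.

Lemma sphere_compact n : compact [set: sphere R n].
Proof.
elim: n => [|n IHn]; last exact: smash_compact IHn circle_compact.
exact: bool_compact.
Qed.
End sphere_compact.

Definition Skl (R : realType) (k l : nat) : spectrum R :=
  @Spectrum R (fun n => Gkl R k l (sphere R n))
    (fun n => assembly R k l (circle R) (@sphere_compact R n)).

Section PU.
Context (R : realType) (k : nat).
Local Notation C := (cplx R).

Definition unitary_group :=
  set_type [set A : 'M[C]_k | A \is unitarymx].
HB.instance Definition _ := Topological.on unitary_group.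

(** [U(1)] is the group of the scalar matrices [z%:M] with [`|z| = 1]. *)
Let PU_rel (A B : unitary_group) : bool :=
  `[< exists2 z : C, `|z| = 1 & \val B = z *: \val A >].

Local Lemma PU_rel_refl : reflexive PU_rel.
Proof. by move=> A; apply/asboolP; exists 1; rewrite ?normr1 ?scale1r. Qed.

Local Lemma PU_rel_sym : symmetric PU_rel.
Proof.
suff H A B : PU_rel A B -> PU_rel B A by move=> A B; apply/idP/idP; exact: H.
move=> /asboolP[z z1 BA]; apply/asboolP; exists z^-1.
  by rewrite normfV z1 invr1.
by rewrite BA scalerA mulVf ?scale1r// -normr_gt0 z1.
Qed.

Local Lemma PU_rel_trans : transitive PU_rel.
Proof.
move=> B A D /asboolP[z z1 BA] /asboolP[w w1 DB]; apply/asboolP.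
by exists (w * z); rewrite ?normrM ?z1 ?w1 ?mulr1// DB BA scalerA.
Qed.

Definition PU_equiv := EquivRel PU_rel PU_rel_refl PU_rel_sym PU_rel_trans.

Definition PU := quotient_topology {eq_quot PU_equiv}.
HB.instance Definition _ := Topological.on PU.
End PU.

(* Main.v *)
(** A nonzero *-homomorphism [C_0(X, M_k) -> M_k], for [X] compact, is
    [F |-> U^* F(x) U] for a unitary [U] and a point [x] other than the base
    point: a vector [v] that is a common eigenvector of the images of the
    functions [a E_00] yields a character [a |-> a x], and the images of [v]
    under matrix units give [k] orthonormal vectors, the rows of [U], which
    leave no room for multiplicity.  Hence [G_{k,k}(X)] is [PU(k)_+ /\ X] for
    [X] a sphere, first as a set and then, by compactness, topologically.  These
    homeomorphisms commute with the assembly maps, so the two spectra are even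
    isomorphic level by level. *)

Require Import Defs.
From Stdlib Require Import Relations.
From mathcomp Require Import all_boot all_order all_algebra generic_quotient.
From mathcomp Require Import spectral complex.
From mathcomp Require Import all_classical all_reals all_analysis.

Set Implicit Arguments.
Unset Strict Implicit.
Unset Printing Implicit Defensive.

Import Order.TTheory GRing.Theory Num.Theory numFieldNormedType.Exports.

Local Open Scope classical_set_scope.
Local Open Scope ring_scope.
Local Open Scope quotient_scope.
Local Open Scope complex_scope.
Local Open Scope sesquilinear_scope.

(** * Spectra and compact spaces *)

Lemma ptmap_eq (X Y : ptopologicalType) (f g : ptmap X Y) :
  (forall x, f x = g x) -> f = g.
Proof.
case: f g => f fc f0 [g gc g0] /= /funext fg; case: _ / fg in gc g0 *.
by congr PtMap; exact: Prop_irrelevance.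
Qed.

Lemma smash_mapE (X X' Y Y' : ptopologicalType) (f : ptmap X X')
    (g : ptmap Y Y') (a : X * Y) :
  smash_map f g (smash_pair a) = smash_pair (f a.1, g a.2).
Proof.
apply: (@smash_lift_pair _ _ _
  (fun a : X * Y => smash_pair (f a.1, g a.2)) _ _ a) => [y|x].
- exact: Defs.smash_map_pointl.
- exact: Defs.smash_map_pointr.
Qed.

Lemma smash_eq_point (X Y : ptopologicalType) (a : X * Y) :
  smash_pair a = point -> a.1 = point \/ a.2 = point.
Proof.
move=> /eqmodP/orP[/eqP -> | /andP[/orP[] /eqP ? _]].
- by left.
- by left.
- by right.
Qed.

Lemma susp_mapE (R : realType) (X Y : ptopologicalType) (f : ptmap X Y) x y :
  susp_map R f (smash_pair (x, y)) = smash_pair (f x, y).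
Proof. exact: (smash_mapE f (pid _) (x, y)). Qed.

Lemma susp_mapK (R : realType) (X Y : ptopologicalType) (f : ptmap X Y)
    (g : ptmap Y X) : cancel f g -> cancel (susp_map R f) (susp_map R g).
Proof.
move=> fK z; have [[x y] ->] := smash_pair_surj z.
apply: (etrans (congr1 (susp_map R g) (susp_mapE f x y))).
by apply: (etrans (susp_mapE g (f x) y)); rewrite fK.
Qed.

Lemma susp_map_pcomp (R : realType) (X Y Z : ptopologicalType) (g : ptmap Y Z)
    (f : ptmap X Y) z :
  susp_map R (Defs.pcomp g f) z = susp_map R g (susp_map R f z).
Proof.
have [[x y] ->] := smash_pair_surj z.
apply: (etrans (susp_mapE (Defs.pcomp g f) x y)); apply: esym.
apply: (etrans (congr1 (susp_map R g) (susp_mapE f x y))).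
exact: susp_mapE.
Qed.

Section map_pi_theory.
Context (R : realType) (E F : spectrum R) (f : spectrum_map E F) (m : int).

Lemma map_germ_step (x y : germ E m) :
  germ_step x y -> germ_step (map_germ f x) (map_germ f y).
Proof.
case=> [p q e h h' [H [Hc H0 H1 Hp]] | p q e h].
- apply: germ_homotopic; exists (f q \o H); split.
  + move=> a; apply: (cvg_comp _ _ (Hc a)).
    exact: ptmap_continuous.
  + by move=> a /=; rewrite H0.
  + by move=> a /=; rewrite H1.
  + by move=> t t01 /=; rewrite Hp// ptmap_point.
- rewrite /map_germ /=.
  rewrite [Defs.pcomp (f q.+1) _](_ : _ =
      Defs.pcomp (bond F q) (susp_map R (Defs.pcomp (f q) h))).
    exact: germ_susp.
  apply: ptmap_eq => z; apply: (etrans (map_bond f (susp_map R h z))).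
  exact: (congr1 (bond F q) (esym (susp_map_pcomp (f q) h z))).
Qed.

(** The germ picked by [repr] is joined to [x] by a chain of steps, and [map_germ f] carries each
    step to a step, so the choice is immaterial. *)
Lemma map_pi_pi (x : germ E m) :
  map_pi f (\pi_(stable_pi E m) x) = \pi_(stable_pi F m) (map_germ f x).
Proof.
rewrite /map_pi; apply/eqmodP/asboolP.
have /eqmodP/asboolP : repr (\pi_(stable_pi E m) x) = x %[mod stable_pi E m].
  by rewrite reprK.
move: (repr _) => y; elim=> [a b ab|a|a b _ IH|a b c _ IH1 _ IH2].
- by apply: rst_step; exact: map_germ_step.
- exact: rst_refl.
- exact: rst_sym.
- exact: rst_trans IH1 IH2.
Qed.
End map_pi_theory.

Lemma map_pi_cancel (R : realType) (E F : spectrum R) (f : spectrum_map E F)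
    (g : spectrum_map F E) (m : int) :
  (forall n, cancel (f n) (g n)) ->
  cancel (map_pi f (m := m)) (map_pi g (m := m)).
Proof.
move=> fK x; have [a ->] : exists a, x = \pi_(stable_pi E m) a.
  by exists (repr x); rewrite reprK.
apply: (etrans (congr1 (map_pi g (m := m)) (map_pi_pi f a))).
apply: (etrans (map_pi_pi g _)); apply: (congr1 (\pi_(stable_pi E m))).
case: a => p q e h; apply: (congr1 (@Germ _ _ _ p q e)).
by apply: ptmap_eq => z /=; rewrite fK.
Qed.

(** The inverses [g n] commute with the bonds automatically, because [f] does and is levelwise
    injective. They thus form a spectrum map, which inverts [f] already on germs. *)
Lemma levelwise_iso_stable_equivalence (R : realType) (E F : spectrum R)
    (f : spectrum_map E F) (g : forall n, ptmap (F n) (E n)) :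
  (forall n, cancel (f n) (g n)) -> (forall n, cancel (g n) (f n)) ->
  stable_equivalence f.
Proof.
move=> fK gK.
have gB n z : g n.+1 (bond F n z) = bond E n (susp_map R (g n) z).
  apply: (can_inj (fK n.+1)); rewrite gK map_bond.
  by apply: (congr1 (bond F n)); apply: esym; exact: (susp_mapK (gK n)).
pose G := SpectrumMap gB => m; exists (map_pi G (m := m)).
- exact: (map_pi_cancel (g := G)).
- exact: (map_pi_cancel (f := G)).
Qed.

(** A closed subset of [X] is compact, so its image is compact and hence closed in [Y]; this image
    is the preimage under the inverse. *)
Lemma compact_hausdorff_homeo (X Y : ptopologicalType) (f : ptmap X Y) :
  compact [set: X] -> hausdorff_space Y ->
  injective f -> (forall y, exists x, f x = y) ->
  exists g : ptmap Y X, cancel f g /\ cancel g f.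
Proof.
move=> cX hY f_inj /choice[g gK]; have fK : cancel f g by exact: inj_can_sym.
have gc : continuous g.
  apply/continuous_closedP => A cA.
  have -> : g @^-1` A = f @` A.
    apply/seteqP; split=> [y Ay|y [x Ax <-]]; first by exists (g y).
    by rewrite /preimage /= fK.
  apply: compact_closed => //; apply: continuous_compact.
    by apply: continuous_subspaceT; exact: ptmap_continuous.
  exact: subclosed_compact cA cX _.
have g0 : g point = point by rewrite -(ptmap_point f) fK.
by exists (PtMap gc g0).
Qed.

Lemma set_type_compact (T : topologicalType) (A : set T) :
  compact A -> compact [set: set_type A].
Proof.
(* A nonempty [A] supplies the default value that [insubd] takes outside [A]; on [A] this map is the
   identity, hence continuous there. *)
have [->|/set0P[a Aa]] := eqVneq A set0.
  move=> _; rewrite (_ : [set: _] = set0); first exact: compact0.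
  by apply/seteqP; split=> // -[x xA]; have := set_mem xA.
move=> cA; pose a' : set_type A := exist _ a (mem_set Aa).
have -> : [set: set_type A] = insubd a' @` A.
  apply/seteqP; split=> // c _.
  by exists (\val c); [exact: set_valP | exact: valKd].
apply: continuous_compact => //; apply/subspace_sigL_continuousP.
rewrite [sigL _ _](_ : _ = id); first by move=> x; exact: cvg_id.
by apply/funext => x; exact: valKd.
Qed.

Lemma add_point_compact (T : topologicalType) :
  compact [set: T] -> compact [set: add_point T].
Proof.
move=> cT; have -> : [set: add_point T] = [set None] `|` Some @` [set: T].
  by apply/seteqP; split=> // -[x|] _; [right; exists x | left].
apply: compactU; first exact: compact_set1.
apply: continuous_compact => //; apply: continuous_subspaceT.
by apply/continuousP => A.
Qed.

Lemma separated_hausdorff (Y : topologicalType) :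
  (forall y z : Y, y != z -> exists (Z : topologicalType) (f : Y -> Z),
    [/\ hausdorff_space Z, continuous f & f y != f z]) -> hausdorff_space Y.
Proof.
move=> sep y z yz; apply/eqP/negPn/negP => /sep[Z [f [hZ fc /eqP]]]; apply.
apply: hZ => A B Ay Bz.
have [t [At Bt]] := yz _ _ (fc _ _ Ay) (fc _ _ Bz).
by exists (f t).
Qed.

Lemma Gkl_hausdorff (R : realType) (k l : nat) (X : ptopologicalType) :
  hausdorff_space (Gkl R k l X).
Proof.
apply: separated_hausdorff => phi psi /eqP ne.
have [f [i [j fij]]] : exists f i j, G_fun phi f i j != G_fun psi f i j.
  apply: contrapT => h; apply: ne; apply: G_fun_inj; apply/funext => f.
  apply/matrixP => i j; apply: contrapT => /eqP e; apply: h.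
  by exists f, i, j.
exists (cplx R), (fun phi => G_fun phi f i j); split=> //.
by have /mx_continuousP := @G_eval_continuous R k l X f; apply.
Qed.

(** * Matrices *)

(** The diagonal entries of [A *m A ^t*] are the squared norms of the rows of [A]. *)
Lemma mul_adjmx_eq0 (C : numClosedFieldType) m n (A : 'M[C]_(m, n)) :
  A *m A ^t* = 0 -> A = 0.
Proof.
move=> AA; apply/row_matrixP => i; rewrite row0; apply/eqP; apply/negPn/negP.
move=> /dotmx_is_dotmx; rewrite dotmxE.
suff -> : (row i A *m (row i A) ^t*) 0 0 = (A *m A ^t*) i i.
  by rewrite AA mxE ltxx.
by rewrite !mxE; apply: eq_bigr => j _; rewrite !mxE.
Qed.

Lemma comm_rank_drop (C : numClosedFieldType) n (B A : 'M[C]_n) :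
  B != 0 -> B *m A = A *m B ->
  exists lam, (\rank (B *m (A - lam%:M)) < \rank B)%N.
Proof.
move=> B0 BA; have rB : (0 < \rank B)%N by rewrite lt0n mxrank_eq0.
have /submxP[M ME] : (row_base B *m A <= row_base B)%MS.
  by rewrite (eqmxMr _ (eq_row_base B)) eq_row_base BA submxMl.
have [lam /eigenvalueP[w wM w0]] := eigenvalue_closed M rB; exists lam.
have := mxrank_mul_ker B (A - lam%:M); set K := (_ :&: _)%MS => <-.
rewrite -[X in (X < _)%N]addn0 ltn_add2l lt0n mxrank_eq0.
have v0 : w *m row_base B != 0.
  apply: contra w0 => /eqP wB0.
  by apply/eqP/(row_free_inj (row_base_free B)); rewrite mul0mx.
apply: contra v0 => /eqP K0; rewrite -submx0 -K0 sub_capmx.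
rewrite (submx_trans (submxMl _ _)) ?eq_row_base//=; apply/sub_kermxP.
by rewrite mulmxBr -mulmxA ME mulmxA wM mul_mx_scalar scalemxAl subrr.
Qed.

(** Commutation with the matrix units, read entrywise, kills the off-diagonal entries and equates
    the diagonal ones. *)
Lemma commutes_all_scalar (C : fieldType) k (W : 'M[C]_k) (i0 : 'I_k) :
  (forall M, W *m M = M *m W) -> W = (W i0 i0)%:M.
Proof.
move=> WM; have WE i j p q : W p i * (q == j)%:R = (p == i)%:R * W j q.
  have /matrixP/(_ p q) := WM (delta_mx i j).
  rewrite !mxE (bigD1 i)//= big1 => [|r ri]; last first.
    by rewrite mxE (negPf ri) mulr0.
  rewrite mxE eqxx addr0 (bigD1 j)//= big1 => [|r rj].
    by rewrite mxE eqxx andbT addr0.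
  by rewrite mxE (negPf rj) andbF mul0r.
apply/matrixP => p q; rewrite mxE.
have [<-|pq] := eqVneq p q.
  by have := WE p i0 p i0; rewrite !eqxx mulr1 mul1r.
by have := WE q q p q; rewrite eqxx mulr1 (negPf pq) mul0r.
Qed.

Lemma scalemx_conj (C : fieldType) k (A M B : 'M[C]_k) a :
  A *m (a *: M) *m B = a *: (A *m M *m B).
Proof. by rewrite -scalemxAr -scalemxAl. Qed.

(** The matrix [V *m U ^t*] commutes with every matrix, so it is a scalar [z]; unitarity of [U] and
    [V] forces modulus 1. *)
Lemma unitary_conj_eq (C : numClosedFieldType) k (U V : 'M[C]_k) :
  (0 < k)%N -> U \is unitarymx -> V \is unitarymx ->
  (forall M, U ^t* *m M *m U = V ^t* *m M *m V) ->
  exists2 z : C, `|z| = 1 & V = z *: U.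
Proof.
move=> k_gt0 /unitarymxP UU /unitarymxP VV UV; pose i0 := Ordinal k_gt0.
pose W := V *m U ^t*.
have WM M : W *m M = M *m W.
  transitivity (V *m (U ^t* *m M *m U) *m U ^t*).
    by rewrite /W -!mulmxA UU mulmx1.
  by rewrite UV /W !mulmxA VV mul1mx.
pose z := W i0 i0; have Wz : W = z%:M by exact: commutes_all_scalar.
have VE : V = z *: U.
  by rewrite -mul_scalar_mx -Wz /W -mulmxA (mulmx1C UU) mulmx1.
exists z => //; have := VV.
rewrite VE linearZ map_mxZ /= -scalemxAl -scalemxAr UU scalerA.
move=> /matrixP/(_ i0 i0); rewrite !mxE eqxx mulr1 -normCK => /eqP.
by rewrite sqrp_eq1// => /eqP.
Qed.

Lemma conj_scalemx (C : numClosedFieldType) k (z : C) (U M : 'M[C]_k) :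
  (z *: U) ^t* *m M *m (z *: U) = `|z| ^+ 2 *: (U ^t* *m M *m U).
Proof.
rewrite [(z *: U)^T]linearZ map_mxZ /= -!scalemxAl -scalemxAr scalerA.
by rewrite mulrC -normCK.
Qed.

(** * Classification of the *-homomorphisms *)

Section character.
Context (R : realType) (X : ptopologicalType) (phi : Gkl R 1 1 X).
Local Notation C := (cplx R).

Let chi (a : C0 R X 1) : C := G_fun phi a 0 0.
Let ev (a : C0 R X 1) (x : X) : C := a x 0 0.

Let ev_continuous a : continuous (ev a).
Proof. by have /mx_continuousP := @C0_continuous R X 1 a; apply. Qed.

Let chiD a b : chi (a + b) = chi a + chi b.
Proof. by rewrite /chi G_funD mxE. Qed.

Let chiZ c a : chi (c *: a) = c * chi a.
Proof. by rewrite /chi G_funZ mxE. Qed.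

Let chiM a b : chi (C0_mul a b) = chi a * chi b.
Proof. by rewrite /chi G_mul mxE big_ord1. Qed.

Let chiS a : chi (C0_star a) = (chi a)^*.
Proof. by rewrite /chi G_star !mxE. Qed.

(** This is [|chi a|^2 - |a - chi a|^2], expanded so that the constant terms, which do not vanish at
    the base point, cancel. Its value at [x] equals its image under [chi] exactly when [a x] equals
    [chi a]. *)
Let sqdist a : C0 R X 1 :=
  (chi a)^* *: a + chi a *: C0_star a + (-1) *: C0_mul (C0_star a) a.

Let chi_sqdist a : chi (sqdist a) = `|chi a| ^+ 2.
Proof.
rewrite /sqdist !chiD !chiZ chiM !chiS normCK mulN1r.
by rewrite [_^* * _]mulrC addrK.
Qed.

Let ev_sqdist a x :
  chi (sqdist a) - ev (sqdist a) x = `|ev a x - chi a| ^+ 2.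
Proof.
rewrite chi_sqdist /ev /sqdist /= !mxE big_ord1 !mxE !normCK rmorphB /=.
set z := a x 0 0; set w := chi a; rewrite !mulrBl !mulrBr.
rewrite mulN1r [z^* * z]mulrC [w^* * z]mulrC.
by rewrite opprB !opprD opprK addrC !addrA addrAC.
Qed.

(** Otherwise [b = a / (chi a - a)] is in [C_0(X)] and [chi a *: b - b a = a]. Applying [chi] gives
    [chi a = 0], the value of [a] at the base point. *)
Let chi_hit a : exists x, ev a x = chi a.
Proof.
apply: contrapT => /forallNP an.
have d_neq0 x : chi a - ev a x != 0.
  by rewrite subr_eq0 eq_sym; apply/eqP; exact: an.
have bP : (fun x => (ev a x / (chi a - ev a x))%:M : 'M[C]_1) \in
    @C0_pred R X 1.
  apply/C0_predP; split; last first.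
    by rewrite /ev C0_point mxE mul0r raddf0.
  apply/mx_continuousP => i j x; rewrite (ord1 i) (ord1 j).
  under eq_fun do rewrite mxE eqxx mulr1n.
  apply: cvgM; first exact: ev_continuous.
  apply: cvgV => //; apply: cvgB; first exact: cvg_cst.
  exact: ev_continuous.
pose b := MkC0 bP.
have ab : chi a *: b + (-1) *: C0_mul b a = a.
  apply/val_inj/funext => x; apply/matrixP => i j; rewrite (ord1 i) (ord1 j).
  rewrite /= !mxE big_ord1 !mxE eqxx mulr1n mulN1r -/(ev a x).
  by rewrite [X in _ - X]mulrC -mulrBl mulrCA divff ?mulr1.
have /eqP := congr1 chi ab.
rewrite chiD !chiZ chiM mulN1r [X in _ - X]mulrC subrr eq_sym => /eqP chi0.
by have := d_neq0 point; rewrite chi0 /ev C0_point mxE subrr eqxx.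
Qed.

(** The sets where [a] takes the value [chi a] are closed. Any finitely many of them meet, so by
    compactness they all have a common point. *)
Lemma character_eval : compact [set: X] ->
  exists x, forall a, G_fun phi a = a x.
Proof.
pose Z a := [set x | ev a x = chi a].
have Zseq (s : seq (C0 R X 1)) : exists x, forall a, a \in s -> Z a x.
  suff [b bs] : exists b,
      forall x, ev b x = chi b -> forall a, a \in s -> Z a x.
    by have [x xb] := chi_hit b; exists x; exact: bs.
  elim: s => [|a s [b bs]]; first by exists 0.
  (* Where this sum takes its value under [chi], two squared moduli add up to 0, so both [a] and [b]
     take theirs. *)
  exists (sqdist a + sqdist b) => x.
  rewrite chiD /ev /= mxE => /esym/eqP.
  rewrite -subr_eq0 opprD addrACA !ev_sqdist.
  rewrite paddr_eq0 ?exprn_ge0// !expf_eq0 /= !normr_eq0 !subr_eq0.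
  move=> /andP[/eqP ea /eqP eb] c; rewrite inE => /predU1P[->//|]; exact: bs.
rewrite compact_In0 => /(_ _ setT Z)[].
- exists Z => a _; last by rewrite setTI.
  rewrite /Z (_ : mkset _ = ev a @^-1` [set chi a]) //.
  apply: preimage_closed; last first.
    apply: accessible_closed_set1; apply: hausdorff_accessible.
    exact: (@norm_hausdorff _ C).
  by move=> x _; exact: ev_continuous.
- by move=> D _; have [x xD] := Zseq (finmap.enum_fset D); exists x.
- move=> x Zx; exists x => a; apply/matrixP => i j; rewrite (ord1 i) (ord1 j).
  exact: esym (Zx a I).
Qed.
End character.

Section tensor.
Context (R : realType) (X : ptopologicalType) (n : nat).
Local Notation C := (cplx R).

Lemma C0_tensor_subproof (a : C0 R X 1) (M : 'M[C]_n) :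
  (fun x => a x 0 0 *: M) \in @C0_pred R X n.
Proof.
apply/C0_predP; split; last by rewrite C0_point mxE scale0r.
apply/mx_continuousP => i j x; under eq_fun do rewrite mxE.
apply: cvgM; last exact: cvg_cst.
by have /mx_continuousP/(_ 0 0 x) := @C0_continuous R X 1 a.
Qed.

(** The elementary tensor of [a] and [M], under the identification of [C_0(X, M_n)] with the tensor
    product of [C_0(X)] and [M_n]. *)
Definition C0_tensor a M : C0 R X n := MkC0 (C0_tensor_subproof a M).

Lemma C0_coef_subproof (F : C0 R X n) i j :
  (fun x => (F x i j)%:M : 'M[C]_1) \in @C0_pred R X 1.
Proof.
apply/C0_predP; split; last by rewrite C0_point mxE raddf0.
apply/mx_continuousP => p q x; rewrite (ord1 p) (ord1 q).
under eq_fun do rewrite mxE eqxx mulr1n.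
by have /mx_continuousP/(_ i j x) := @C0_continuous R X n F.
Qed.

Definition C0_coef F i j : C0 R X 1 := MkC0 (C0_coef_subproof F i j).

Lemma C0_tensorM a b M N :
  C0_mul (C0_tensor a M) (C0_tensor b N) = C0_tensor (C0_mul a b) (M *m N).
Proof.
apply/val_inj/funext => x /=.
by rewrite mxE big_ord1 -scalemxAl -scalemxAr scalerA.
Qed.

Lemma C0_tensor_star a M :
  C0_star (C0_tensor a M) = C0_tensor (C0_star a) (M ^t*).
Proof. by apply/val_inj/funext => x /=; rewrite linearZ map_mxZ !mxE. Qed.

Lemma C0_tensor_linear c a b M :
  C0_tensor (c *: a + b) M = c *: C0_tensor a M + C0_tensor b M.
Proof.
by apply/val_inj/funext => x; rewrite /= !mxE scalerDl -scalerA.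
Qed.

Lemma C0_mulC1 (a b : C0 R X 1) : C0_mul a b = C0_mul b a.
Proof.
apply/val_inj/funext => x; apply/matrixP => i j.
by rewrite !(ord1 i) !(ord1 j) !mxE !big_ord1 mulrC.
Qed.

Lemma C0_sumE (I : Type) (r : seq I) (F : I -> C0 R X n) x :
  (\sum_(i <- r) F i) x = \sum_(i <- r) F i x.
Proof. by elim: r => [|i r IHr]; rewrite ?big_nil// !big_cons -IHr. Qed.

(** Right multiplication by [F] is rewritten with its coefficients placed at the corner [(i0, i0)],
    where they act on a common eigenvector by scalars. *)
Lemma C0_tensor_deltaM a i0 i (F : C0 R X n) :
  C0_mul (C0_tensor a (delta_mx i0 i)) F =
  \sum_j C0_mul (C0_tensor (C0_coef F i j) (delta_mx i0 i0))
                (C0_tensor a (delta_mx i0 j)).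
Proof.
under eq_bigr => j _ do rewrite C0_tensorM mul_delta_mx.
apply/val_inj/funext => x.
apply: etrans (esym (C0_sumE _ _ _)); rewrite /= -scalemxAl.
under eq_bigr => j _ do rewrite mxE big_ord1 mxE eqxx mulr1n mulrC -scalerA.
rewrite -scaler_sumr; congr (_ *: _).
apply/matrixP => p q.
rewrite mxE summxE (bigD1 i)//= [X in _ + X]big1 => [|r ri].
  rewrite addr0 (bigD1 q)//= big1 => [|r rq].
    by rewrite !mxE !eqxx !andbT addr0 mulrC.
  by rewrite !mxE [q == r]eq_sym (negPf rq) andbF mulr0.
by rewrite mxE (negPf ri) andbF mul0r.
Qed.
End tensor.

Section classification.
Context (R : realType) (k : nat) (i0 : 'I_k) (X : ptopologicalType).
Context (phi : Gkl R k k X).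
Local Notation C := (cplx R).

(** The restriction of [phi] to a corner isomorphic to the commutative algebra [C_0(X)]. *)
Let psi (a : C0 R X 1) := G_fun phi (C0_tensor a (delta_mx i0 i0)).

Let psi_linear c a b : psi (c *: a + b) = c *: psi a + psi b.
Proof. by rewrite /psi C0_tensor_linear G_linear. Qed.

Let psiM a b : psi (C0_mul a b) = psi a *m psi b.
Proof. by rewrite /psi -G_mul C0_tensorM mul_delta_mx. Qed.

Let psiS a : psi (C0_star a) = (psi a) ^t*.
Proof.
by rewrite /psi -G_star C0_tensor_star trmx_delta map_delta_mx.
Qed.

Let psiC a b : psi a *m psi b = psi b *m psi a.
Proof. by rewrite -!psiM C0_mulC1. Qed.

(** If [psi] vanishes, then so does [phi] on column [i0], since [N *m N ^t* = 0] for the adjoint [N]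
    of such an image. Then it vanishes on all matrix units, as [e_ii = e_(i,i0) e_(i0,i)], and
    tensors with these span. *)
Let psi_neq0 : phi <> point -> exists a, psi a != 0.
Proof.
apply: contra_notP => /forallNP psi0.
have {}psi0 a : psi a = 0 by apply/eqP/negPn/negP/psi0.
have col0 a i : G_fun phi (C0_tensor a (delta_mx i i0)) = 0.
  rewrite -[LHS]trmxCK -G_star; set N := G_fun _ _.
  rewrite (@mul_adjmx_eq0 _ _ _ N) ?trmx0 ?map_mx0//.
  rewrite /N -G_star -G_mul !C0_tensor_star C0_tensorM.
  rewrite !(trmx_delta, map_delta_mx) mul_delta_mx; exact: psi0.
have all0 a i j : G_fun phi (C0_tensor a (delta_mx i j)) = 0.
  apply: mul_adjmx_eq0; rewrite -G_star -G_mul C0_tensor_star C0_tensorM.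
  rewrite trmx_delta map_delta_mx mul_delta_mx -(mul_delta_mx i0).
  by rewrite -C0_tensorM G_mul col0 mul0mx.
apply: G_fun_inj; apply/funext => F.
have -> : F = \sum_i \sum_j C0_tensor (C0_coef F i j) (delta_mx i j).
  apply/val_inj/funext => x.
  apply: etrans (esym (C0_sumE _ _ _)); rewrite [LHS]matrix_sum_delta.
  apply: eq_bigr => i _; apply: etrans (esym (C0_sumE _ _ _)).
  by apply: eq_bigr => j _; rewrite /= mxE eqxx mulr1n.
have phi_sum (F' : 'I_k -> C0 R X k) :
    (forall i, G_fun phi (F' i) = 0) -> G_fun phi (\sum_i F' i) = 0.
  move=> F'0; elim/big_ind : _ => // [|f g f0 g0]; first exact: G_fun0.
  by rewrite G_funD f0 g0 addr0.
by apply: (phi_sum) => i; apply: phi_sum => j; exact: all0.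
Qed.

(** A nonzero [psi b] of minimal rank is a common eigenvector of the commuting
    family [psi]: otherwise, by [comm_rank_drop], some [psi (b * a - lam b)]
    would be nonzero of smaller rank. *)
Let psi_eigen : phi <> point ->
  exists2 b, psi b != 0 & forall a, exists lam, psi b *m psi a = lam *: psi b.
Proof.
move=> /psi_neq0[a0 a0_neq0].
pose P r := `[< exists2 a, psi a != 0 & \rank (psi a) = r >].
have exP : exists r, P r by exists (\rank (psi a0)); apply/asboolP; exists a0.
case: (ex_minnP exP) => r /asboolP[b b0 br] rmin; exists b => // a.
have [lam lt] := comm_rank_drop b0 (psiC b a); exists lam.
apply/eqP; rewrite -subr_eq0; apply/negPn/negP => n0.
have psiE : psi ((- lam) *: b + C0_mul b a) = psi b *m psi a - lam *: psi b.
  by rewrite psi_linear psiM scaleNr addrC.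
have /rmin : P (\rank (psi b *m (psi a - lam%:M))).
  apply/asboolP; exists ((- lam) *: b + C0_mul b a); rewrite psiE//.
  by rewrite mulmxBr mul_mx_scalar.
by rewrite leqNgt -br lt.
Qed.

(** Each nonzero row of the matrix [psi b] from [psi_eigen] is a common eigenvector; it remains to
    normalize it. *)
Let unit_eigenvector : phi <> point ->
  exists2 v : 'rV[C]_k, v *m v ^t* = 1%:M &
    (forall a, exists lam, v *m psi a = lam *: v) /\ exists a, v *m psi a != 0.
Proof.
move=> /psi_eigen[b b0 eig].
have [i bi] : exists i, row i (psi b) != 0.
  apply: contrapT => /forallNP h; move/eqP: b0; apply.
  by apply/row_matrixP => i; rewrite row0; apply/eqP/negPn/negP/h.
set w := row i (psi b) in bi.
have wE a lam : psi b *m psi a = lam *: psi b -> w *m psi a = lam *: w.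
  by move=> ba; rewrite /w -row_mul ba linearZ.
have ww : 0 < dotmx w w by exact: dotmx_is_dotmx.
pose c := (sqrtC (dotmx w w))^-1.
have c_gt0 : 0 < c by rewrite invr_gt0 sqrtC_gt0.
exists (c *: w); last split.
- rewrite linearZ map_mxZ -scalemxAl -scalemxAr scalerA [w *m _]mx11_scalar.
  rewrite -dotmxE -[X in _ *: X]scalemx1 scalerA.
  rewrite /= (CrealP _) ?gtr0_real// -expr2 /c exprVn sqrtCK mulVf ?scale1r//.
  by rewrite gt_eqF.
- move=> a; have [lam /wE wa] := eig a; exists lam.
  by rewrite -scalemxAl wa !scalerA mulrC.
(* The eigenvalue at the adjoint of [b] is nonzero because [psi b *m (psi b) ^t*] is. *)
- have [lam ba] := eig (C0_star b); exists (C0_star b).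
  rewrite -scalemxAl (wE _ _ ba) !scaler_eq0 (gt_eqF c_gt0) (negPf bi) orbF /=.
  apply: contra b0 => /eqP lam0; apply/eqP/mul_adjmx_eq0.
  by rewrite -psiS ba lam0 scale0r.
Qed.

(** For a unit common eigenvector the eigenvalue is [v *m psi a *m v ^t*]. It is a character in [a],
    hence an evaluation. *)
Let eigenvector_eval (v : 'rV[C]_k) : compact [set: X] ->
  v *m v ^t* = 1%:M -> (forall a, exists lam, v *m psi a = lam *: v) ->
  exists x, forall a, v *m psi a = a x 0 0 *: v.
Proof.
move=> cX vv eig; pose chi a : 'M[C]_1 := v *m psi a *m v ^t*.
have chiE a lam : v *m psi a = lam *: v -> chi a = lam%:M.
  by move=> va; rewrite /chi va -scalemxAl vv scalemx1.
have chiP : @star_hom R 1 1 X chi.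
  split=> [c a b|a b|a].
  - by rewrite /chi psi_linear mulmxDr mulmxDl -scalemxAr -scalemxAl.
  - have [lam va] := eig a; rewrite (chiE _ _ va) /chi psiM mulmxA va.
    by rewrite mul_scalar_mx -!scalemxAl.
  - rewrite /chi psiS trmx_mul map_mxM trmxCK trmx_mul map_mxM mulmxA.
    by [].
have [x xE] := character_eval (MkG chiP) cX; exists x => a.
have [lam va] := eig a; rewrite va; congr (_ *: v).
have := xE a; rewrite /G_fun /= (chiE _ _ va) => /matrixP/(_ 0 0).
by rewrite mxE eqxx mulr1n => ->.
Qed.

Lemma Gkl_eval : compact [set: X] -> exists U x,
  U \is unitarymx /\ forall F, G_fun phi F = U ^t* *m F x *m U.
Proof.
move=> cX; have [phi0|/eqP/eqP phi0] := pselect (phi = point).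
  (* The zero homomorphism is evaluation at the base point. *)
  exists 1%:M, point; split=> [|F]; last by rewrite C0_point mulmx0 mul0mx phi0.
  by apply/unitarymxP; rewrite mul1mx trmx1 map_mx1.
have [v vv [eig [a1 a1v]]] := unit_eigenvector phi0.
have [x xE] := eigenvector_eval cX vv eig.
(* A self-adjoint function with value 1 at [x], standing in for a unit. *)
pose a := (`|a1 x 0 0| ^- 2) *: C0_mul (C0_star a1) a1.
have aE y : a y 0 0 = `|a1 x 0 0| ^- 2 * `|a1 y 0 0| ^+ 2.
  by rewrite /a /= !mxE big_ord1 !mxE -normCKC.
have ax1 : a x 0 0 = 1.
  rewrite aE mulVf// expf_neq0//.
  by apply: contra a1v; rewrite normr_eq0 xE => /eqP ->; rewrite scale0r.
have aS : C0_star a = a.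
  apply/val_inj/funext => y; apply/matrixP => i j.
  rewrite (ord1 i) (ord1 j) [LHS]mxE mxE; apply/CrealP; rewrite aE.
  by rewrite rpredM ?rpredV ?rpredX ?normr_real.
pose u i := v *m G_fun phi (C0_tensor a (delta_mx i0 i)).
pose U : 'M[C]_k := \matrix_i u i.
have uF i F : u i *m G_fun phi F = \sum_j F x i j *: u j.
  rewrite /u -mulmxA -G_mul C0_tensor_deltaM.
  have -> (F' : 'I_k -> C0 R X k) :
      G_fun phi (\sum_j F' j) = \sum_j G_fun phi (F' j).
    by apply: (big_morph (G_fun phi)); [exact: G_funD | exact: G_fun0].
  rewrite mulmx_sumr; apply: eq_bigr => j _.
  by rewrite G_mul mulmxA xE /= mxE eqxx mulr1n -scalemxAl.
have UF F : U *m G_fun phi F = F x *m U.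
  apply/row_matrixP => i; rewrite !row_mul rowK uF mulmx_sum_row.
  by apply: eq_bigr => j _; rewrite rowK mxE.
(* The product of [u i] with the adjoint of [u j] is [v] times the image of [a^2] tensor
   [e_(i0,i) e_(j,i0)] times [v ^t*]: it is 0 for distinct indices and [(a x)^2 = 1] otherwise. *)
have Uu : U \is unitarymx.
  apply/row_unitarymxP => i j; rewrite !rowK dotmxE /u.
  rewrite trmx_mul map_mxM -G_star mulmxA -[_ *m G_fun phi _]mulmxA -G_mul.
  rewrite C0_tensor_star aS trmx_delta map_delta_mx C0_tensorM.
  rewrite mul_delta_mx_cond.
  have [ij|ij] := eqVneq i j.
    by rewrite mulr1n -/(psi _) psiM mulmxA !xE -scalemxAl xE !ax1 !scale1r vv
      mxE.
  rewrite mulr0n (_ : C0_tensor _ _ = 0) ?G_fun0 ?mulmx0 ?mul0mx ?mxE//.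
  by apply/val_inj/funext => y /=; rewrite scaler0.
exists U, x; split=> // F.
by rewrite -mulmxA -UF mulmxA (mulmx1C (unitarymxP Uu)) mul1mx.
Qed.
End classification.

(** * Separation of points and compactness of [PU(k)] *)

Section PU_compact.
Context (R : realType).
Local Notation C := (cplx R).

Lemma real_complex_continuous : continuous (fun r : R => r%:C : C).
Proof.
move=> r; apply/cvgrPdist_lt => e e0.
have eE : e = (complex.Re e)%:C by rewrite RRe_real// gtr0_real.
have re0 : 0 < complex.Re e by rewrite -ltcR -eE.
have /cvgrPdist_lt/(_ _ re0) := @cvg_id _ (nbhs r).
apply: filterS => s rs; rewrite eE.
have -> : (r%:C - s%:C : C) = (r - s)%:C by rewrite rmorphB.
have -> : `|(r - s)%:C : C| = (`|r - s|)%:C.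
  by rewrite normc_def /= expr0n addr0 sqrtr_sqr.
by rewrite ltcR.
Qed.

Lemma complex_pair_continuous :
  continuous (fun v : R * R => v.1%:C + 'i%C * v.2%:C : C).
Proof.
move=> v; apply: cvgD; last apply: cvgM; last 2 first.
- exact: cvg_cst.
- by apply: (@continuous_comp _ _ _ snd (fun r : R => r%:C : C));
    [exact: cvg_snd | exact: real_complex_continuous].
- by apply: (@continuous_comp _ _ _ fst (fun r : R => r%:C : C));
    [exact: cvg_fst | exact: real_complex_continuous].
Qed.

(** The entries of a unitary matrix have modulus at most 1, so the unitary matrices form a closed
    subset of a continuous image of a product of squares, compact by Tychonoff. *)
Lemma unitary_group_compact k : compact [set: unitary_group R k].
Proof.
apply: set_type_compact.
pose J : set R := `[-1, 1]%classic.
have cI : compact J by exact: segment_compact.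
have cP := @tychonoff ('I_k * 'I_k)%type (fun=> (R * R)%type) (fun=> J `*` J)
  (fun=> compact_setX cI cI).
pose m (f : prod_topology (fun _ : 'I_k * 'I_k => (R * R)%type)) : 'M[C]_k :=
  \matrix_(i, j) ((f (i, j)).1%:C + 'i%C * (f (i, j)).2%:C).
have mc : continuous m.
  apply/mx_continuousP => i j.
  rewrite [X in continuous X](_ : _ =
    (fun v : R * R => v.1%:C + 'i%C * v.2%:C : C) \o (fun f => f (i, j))).
    move=> f; apply: continuous_comp; last exact: complex_pair_continuous.
    exact: (@proj_continuous _ (fun _ : 'I_k * 'I_k => (R * R)%type) (i, j)).
  by apply/funext => f; rewrite /m mxE.
have cm := continuous_compact (continuous_subspaceT mc) cP.
apply: (subclosed_compact _ cm).
- have -> : [set A : 'M[C]_k | A \is unitarymx] =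
      \bigcap_(ij : 'I_k * 'I_k)
         (fun A : 'M[C]_k => (A *m A ^t*) ij.1 ij.2) @^-1`
         [set (1%:M : 'M[C]_k) ij.1 ij.2].
    apply/seteqP; split=> [A /unitarymxP AA ij _|A AA]; first by rewrite /= AA.
    by apply/unitarymxP/matrixP => i j; exact: (AA (i, j) I).
  apply: closed_bigI => ij _; apply: preimage_closed.
    have /mx_continuousP h : continuous (fun A : 'M[C]_k => A *m A ^t*).
      apply: mulmx_continuous; first by move=> A; exact: cvg_id.
      by apply: adjmx_continuous => A; exact: cvg_id.
    by move=> A _; exact: h.
  apply: accessible_closed_set1; apply: hausdorff_accessible.
  exact: (@norm_hausdorff _ C).
- move=> A /= /unitarymxP AA.
  exists (fun ij => (complex.Re (A ij.1 ij.2), complex.Im (A ij.1 ij.2)));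
    last first.
    by apply/matrixP => i j; rewrite mxE /= -complexE.
  move=> [i j] /=.
  have Aij : (complex.Re (A i j)) ^+ 2 + (complex.Im (A i j)) ^+ 2 <= 1.
    rewrite -lecR (add_Re2_Im2 (A i j)).
    have /matrixP/(_ i i) := AA; rewrite !mxE eqxx mulr1n rmorph1 => <-.
    rewrite (bigD1 j)//= !mxE -normCK lerDl; apply: sumr_ge0 => q _.
    by rewrite !mxE -normCK exprn_ge0.
  have sqr_le1 (x : R) : x ^+ 2 <= 1 -> J x.
    rewrite /J /= in_itv /= -ler_norml -real_normK ?num_real//.
    by rewrite expr_le1.
  by split; apply: sqr_le1; apply: le_trans Aij; rewrite ?lerDl ?lerDr sqr_ge0.
Qed.

Lemma PU_compact k : compact [set: PU R k].
Proof.
have -> : [set: PU R k] = \pi_(PU R k) @` [set: unitary_group R k].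
  by apply/seteqP; split=> // p _; exists (repr p) => //; exact: reprK.
apply: continuous_compact; last exact: unitary_group_compact.
apply: continuous_subspaceT.
exact: (@pi_continuous _ {eq_quot PU_equiv R k}).
Qed.

End PU_compact.

(** Asking for a zero at [y], rather than just distinct values, lets products of functions separate
    points of a smash product. Taking the base point for [y] gives a function that is nonzero at
    [x]. *)
Definition C0_separates (R : realType) (X : ptopologicalType) :=
  forall x y : X, x <> point -> y <> x ->
    exists f : C0 R X 1, f x 0 0 != 0 /\ f y 0 0 = 0.

Section separation.
Context (R : realType).
Local Notation C := (cplx R).

Lemma C0_of_scalar (X : ptopologicalType) (f : X -> C) :
  continuous f -> f point = 0 -> exists F : C0 R X 1, forall x, F x 0 0 = f x.
Proof.
move=> fc f0; have FP : (fun x => (f x)%:M : 'M[C]_1) \in @C0_pred R X 1.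
  apply/C0_predP; split; last by rewrite f0 raddf0.
  apply/mx_continuousP => i j; rewrite (ord1 i) (ord1 j).
  by under eq_fun do rewrite mxE eqxx mulr1n.
by exists (MkC0 FP) => x; rewrite /= mxE eqxx mulr1n.
Qed.

Lemma bool_C0_separates : C0_separates R bool.
Proof.
move=> x y x0 yx; have [] := @C0_of_scalar bool (fun b => b%:R).
- by apply/continuousP => A _; exact: discrete_open.
- by [].
move=> F FE; exists F; rewrite !FE.
by case: x y x0 yx => -[] // _ _; rewrite oner_neq0.
Qed.

(** The product [f x * g y] vanishes on the wedge, hence descends to the smash product. The factor
    with a zero is chosen in a coordinate where the two points differ. *)
Lemma smash_C0_separates (X Y : ptopologicalType) :
  C0_separates R X -> C0_separates R Y -> C0_separates R (smash X Y).
Proof.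
move=> sX sY z w; have [[x y] ->] := smash_pair_surj z.
have [[x' y'] ->] := smash_pair_surj w => xy0 ne.
have x0 : x <> point by move=> x0; apply: xy0; rewrite x0 smash_pair_pointl.
have y0 : y <> point by move=> y0; apply: xy0; rewrite y0 smash_pair_pointr.
have [f [g [fx gy fg]]] : exists (f : C0 R X 1) (g : C0 R Y 1),
    [/\ f x 0 0 != 0, g y 0 0 != 0 & f x' 0 0 * g y' 0 0 = 0].
  have [x'x|/eqP x'x] := eqVneq x' x; last first.
    have [f [fx fx']] := sX x x' x0 x'x.
    have [g [gy _]] := sY y point y0 (nesym y0).
    by exists f, g; rewrite fx' mul0r.
  have [f [fx _]] := sX x point x0 (nesym x0).
  have [|g [gy gy']] := sY y y' y0 _.
    by move=> y'y; apply: ne; rewrite x'x y'y.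
  by exists f, g; rewrite gy' mulr0.
pose h (a : X * Y) : C := f a.1 0 0 * g a.2 0 0.
have hc : continuous h.
  move=> a; apply: cvgM.
    apply: (@continuous_comp _ _ _ fst (fun x => f x 0 0)).
      exact: cvg_fst.
    by have /mx_continuousP := @C0_continuous R X 1 f; apply.
  apply: (@continuous_comp _ _ _ snd (fun x => g x 0 0)); first exact: cvg_snd.
  by have /mx_continuousP := @C0_continuous R Y 1 g; apply.
have hwd : {homo h : a b / \pi_(smash X Y) a == \pi_(smash X Y) b >-> a == b}.
  move=> a b /eqP/eqmodP ab; apply/eqP.
  have h0 c : (c.1 == point) || (c.2 == point) -> h c = 0.
    by rewrite /h => /orP[]/eqP ->; rewrite C0_point mxE ?mul0r ?mulr0.
  by have /orP[/eqP -> //|/andP[/h0 -> /h0 ->]] := ab.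
have hE a : (h \o repr) (smash_pair a) = h a.
  by apply/eqP/hwd; rewrite reprK.
have [||F FE] := @C0_of_scalar (smash X Y) (h \o repr).
- exact: (@repr_comp_continuous _ {eq_quot smash_equiv X Y} _ _ hc hwd).
- by apply: etrans (hE (point, point)) _; rewrite /h /= C0_point mxE mul0r.
exists F; rewrite !FE !hE /h /=; split=> //.
by rewrite mulf_neq0.
Qed.

Lemma circle_C0_separates : C0_separates R (circle R).
Proof.
move=> s t s0 ts.
pose d (u v : circle R) : R :=
  ((\val u).1 - (\val v).1) ^+ 2 + ((\val u).2 - (\val v).2) ^+ 2.
have Dc (w : R * R) :
    continuous (fun z : R * R => (z.1 - w.1) ^+ 2 + (z.2 - w.2) ^+ 2).
  have c1 : continuous (fun z : R * R => z.1 - w.1).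
    by move=> z; apply: cvgB; [exact: cvg_fst | exact: cvg_cst].
  have c2 : continuous (fun z : R * R => z.2 - w.2).
    by move=> z; apply: cvgB; [exact: cvg_snd | exact: cvg_cst].
  by move=> z; apply: cvgD;
    [exact: cvgM (c1 z) (c1 z) | exact: cvgM (c2 z) (c2 z)].
have dc v : continuous (d ^~ v).
  move=> u; apply: (@continuous_comp _ _ _ (fun u : circle R => \val u)
    (fun z => (z.1 - (\val v).1) ^+ 2 + (z.2 - (\val v).2) ^+ 2)).
    exact: initial_continuous.
  exact: Dc.
have dvv v : d v v = 0 by rewrite /d !subrr expr0n addr0.
have d_neq0 u v : v <> u -> d u v != 0.
  move=> vu; rewrite /d paddr_eq0 ?sqr_ge0// !expf_eq0 /= !subr_eq0.
  apply/negP => /andP[/eqP e1 /eqP e2]; apply: vu; apply/val_inj.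
  by rewrite [LHS]surjective_pairing -e1 -e2 -surjective_pairing.
(* The product of the squared distances to the base point and to [t]. *)
have [||F FE] := @C0_of_scalar (circle R) (fun u => (d u point * d u t)%:C).
- move=> u; apply: (@continuous_comp _ _ _ (fun u => d u point * d u t)
    (fun r : R => r%:C : C)); last exact: real_complex_continuous.
  exact: cvgM (dc point u) (dc t u).
- by rewrite dvv mul0r.
exists F; rewrite !FE dvv mulr0; split=> //.
rewrite fmorph_eq0 mulf_neq0// d_neq0//; exact: nesym.
Qed.

Lemma sphere_C0_separates n : C0_separates R (sphere R n).
Proof.
elim: n => [|n IHn]; first exact: bool_C0_separates.
exact: smash_C0_separates IHn circle_C0_separates.
Qed.
End separation.

(** * The levelwise homeomorphism *)

Lemma PU_eqP (R : realType) k (U V : unitary_group R k) :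
  \pi_(PU R k) U = \pi_(PU R k) V <->
  exists2 z : cplx R, `|z| = 1 & \val V = z *: \val U.
Proof.
split=> [/eqmodP/asboolP //|h].
exact: (elimT (@eqmodP _ (PU_equiv R k) U V) (introT (asboolP _) h)).
Qed.

Section conj_eval.
Context (R : realType) (k : nat).
Local Notation C := (cplx R).
Implicit Types (X Y : ptopologicalType).

Lemma conj_eval_subproof X (U : unitary_group R k) (x : X) :
  @star_hom R k k X (fun F => (\val U) ^t* *m F x *m \val U).
Proof.
have /unitarymxP UU : \val U \is unitarymx by exact: (set_valP U).
split=> [a f g|f g|f] /=.
- by rewrite mulmxDr mulmxDl -scalemxAr -scalemxAl.
- by rewrite !mulmxA -[X in _ = X *m _ *m _]mulmxA UU mulmx1.
- by rewrite !trmx_mul !map_mxM trmxCK mulmxA.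
Qed.

Definition conj_eval X U (x : X) : Gkl R k k X := MkG (conj_eval_subproof U x).

Lemma conj_eval_point X U : conj_eval U (point : X) = point.
Proof.
apply: G_fun_inj; apply/funext => F.
by rewrite /G_fun /= C0_point mulmx0 mul0mx.
Qed.

Lemma conj_eval_continuous X (x : X) : continuous (fun U => conj_eval U x).
Proof.
have vc : continuous (fun U : unitary_group R k => \val U : 'M[C]_k).
  exact: initial_continuous.
have vsc : continuous (fun U : unitary_group R k => (\val U : 'M[C]_k) ^t*).
  exact: (@adjmx_continuous C (unitary_group R k) k k (fun U => \val U) vc).
apply: G_continuous => f.
pose g (U : unitary_group R k) : 'M[C]_k := (\val U) ^t* *m f x.
have gc : continuous g.
  apply: (@mulmx_continuous C (unitary_group R k) k k k _ (fun=> f x) vsc).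
  exact: cst_continuous.
exact: (@mulmx_continuous C (unitary_group R k) k k k g
  (fun U => \val U) gc vc).
Qed.

Lemma G_map_conj_eval X Y (h : ptmap X Y) U x :
  G_map R k k h (conj_eval U x) = conj_eval U (h x).
Proof. by apply: G_fun_inj; apply/funext => F. Qed.

Lemma conj_eval_surj X : (0 < k)%N -> compact [set: X] ->
  forall phi : Gkl R k k X, exists U x, phi = conj_eval U x.
Proof.
move=> k_gt0 cX phi; have [U [x [UU phiE]]] := Gkl_eval (Ordinal k_gt0) phi cX.
exists (exist _ U (mem_set UU)), x; apply: G_fun_inj; apply/funext => F.
exact: phiE.
Qed.

Lemma conj_eval_inj X (U V : unitary_group R k) (x y : X) : (0 < k)%N ->
  C0_separates R X -> x <> point -> conj_eval U x = conj_eval V y ->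
  y = x /\ \pi_(PU R k) U = \pi_(PU R k) V.
Proof.
move=> k_gt0 sX x0 eUV; pose i0 := Ordinal k_gt0.
have /unitarymxP UU : \val U \is unitarymx by exact: (set_valP U).
have UV (F : C0 R X k) :
    (\val U) ^t* *m F x *m \val U = (\val V) ^t* *m F y *m \val V.
  exact: (congr1 (fun phi => G_fun phi F) eUV).
have yx : y = x.
  apply: contrapT => yx; have [f [fx fy]] := sX x y x0 yx.
  (* At [f] tensor the identity the two sides are the scalar matrices [f x] and [f y = 0]. *)
  have := UV (C0_tensor f 1%:M); rewrite /= fy scale0r mulmx0 mul0mx.
  rewrite scalemx_conj mulmx1 (mulmx1C UU) => /matrixP/(_ i0 i0).
  by rewrite !mxE eqxx mulr1; exact/eqP.
split=> //; apply: (proj2 (PU_eqP U V)).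
have [f [fx _]] := sX x point x0 (nesym x0).
apply: unitary_conj_eq => //; [exact: (set_valP U) | exact: (set_valP V) |].
move=> M; apply: (scalerI fx); rewrite -!scalemx_conj -{2}yx.
exact: (UV (C0_tensor f M)).
Qed.

Lemma conj_eval_pi X U V (x : X) :
  \pi_(PU R k) U = \pi_(PU R k) V -> conj_eval U x = conj_eval V x.
Proof.
move=> /(proj1 (PU_eqP U V))[z z1 VE]; apply: G_fun_inj; apply/funext => F.
by rewrite /G_fun /= VE conj_scalemx z1 expr1n scale1r.
Qed.
End conj_eval.

Section assembly_bijective.
Context (R : realType) (k : nat) (X Y : ptopologicalType).
Hypotheses (k_gt0 : (0 < k)%N) (cX : compact [set: X]).

Lemma assembly_pair phi y :
  assembly R k k Y cX (smash_pair (phi, y)) = G_map R k k (smash_pairl X y) phi.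
Proof.
apply: (@smash_lift_pair _ _ _
  (fun a => G_map R k k (smash_pairl X a.2) a.1) _ _ (phi, y)) => [y'|psi].
- exact: Defs.assembly_pointl.
- exact: Defs.assembly_pointr.
Qed.

Lemma assembly_conj_eval U x y :
  assembly R k k Y cX (smash_pair (conj_eval U x, y)) =
  conj_eval U (smash_pair (x, y)).
Proof. by rewrite assembly_pair G_map_conj_eval. Qed.

Lemma assembly_surj : compact [set: Y] -> forall psi,
  exists z, assembly R k k Y cX z = psi.
Proof.
move=> cY psi.
have [U [z ->]] := conj_eval_surj k_gt0 (smash_compact cX cY) psi.
have [[x y] ->] := smash_pair_surj z.
by exists (smash_pair (conj_eval U x, y)); exact: assembly_conj_eval.
Qed.

(** Both arguments are written with [conj_eval]; away from the base point the image determines the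
    point of [smash X Y] and the class of the unitary in [PU R k]. *)
Lemma assembly_inj : C0_separates R (smash X Y) ->
  injective (assembly R k k Y cX).
Proof.
move=> sXY.
(* [conj_eval_inj] needs a point other than the base point. Using this claim in both directions
   covers the case where [z] or [w] is the base point. *)
suff pt z w : assembly R k k Y cX z = assembly R k k Y cX w ->
    z = w \/ z = point.
  move=> z w zw; have [//|z0] := pt _ _ zw.
  by have [//|->] := pt _ _ (esym zw).
have [[phi y] ->] := smash_pair_surj z; have [[psi y'] ->] := smash_pair_surj w.
have [U [x ->]] := conj_eval_surj k_gt0 cX phi.
have [V [x' ->]] := conj_eval_surj k_gt0 cX psi.
rewrite !assembly_conj_eval => e.
have [xy0|xy0] := pselect (smash_pair (x, y) = point).
  right; have [/= ->|/= ->] := smash_eq_point xy0.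
    by rewrite conj_eval_point smash_pair_pointl.
  by rewrite smash_pair_pointr.
left; have [xy' UV] := conj_eval_inj k_gt0 sXY xy0 e.
move: xy' => /eqmodP/orP[/eqP[-> ->]|/andP[_ w0]].
  by rewrite (conj_eval_pi _ UV).
case: xy0; have /orP[] := w0 => /eqP /= ->.
  exact: smash_pair_pointl.
exact: smash_pair_pointr.
Qed.
End assembly_bijective.

Section level_maps.
Context (R : realType) (k : nat).

(** The added point goes to the zero homomorphism; [true] is the only point of [S^0] other than the
    base point. *)
Definition PU_eval_fun (p : add_point (PU R k)) : Gkl R k k bool :=
  if p is Some q then conj_eval (repr q) true else point.

Lemma PU_eval_continuous : continuous PU_eval_fun.
Proof.
suff c : continuous (PU_eval_fun \o Some).
  apply/continuousP => A oA; exact: (proj1 (continuousP _) c A oA).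
apply: (@repr_comp_continuous _ {eq_quot PU_equiv R k} _
  (fun U => conj_eval U true)); first exact: conj_eval_continuous.
by move=> U V /eqP UV; apply/eqP; exact: conj_eval_pi.
Qed.

Definition PU_eval : ptmap (add_point (PU R k)) (Gkl R k k bool) :=
  @PtMap (add_point (PU R k)) _ PU_eval_fun PU_eval_continuous erefl.

Lemma PU_eval_surj : (0 < k)%N -> forall phi, exists p, PU_eval p = phi.
Proof.
move=> k_gt0 phi; have [U [b ->]] := conj_eval_surj k_gt0 bool_compact phi.
case: b; last by exists None; rewrite conj_eval_point.
exists (Some (\pi_(PU R k) U)); apply: conj_eval_pi.
exact: reprK.
Qed.

Lemma PU_eval_inj : (0 < k)%N -> injective PU_eval.
Proof.
move=> k_gt0; have sB := @bool_C0_separates R.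
have inj0 (q : PU R k) : conj_eval (repr q) true <> point :> Gkl R k k bool.
  rewrite -(@conj_eval_point _ _ bool (repr q)) => e.
  by have [] := conj_eval_inj k_gt0 sB _ e.
move=> [p|] [q|] //=.
- move=> e; have [//|_] := conj_eval_inj k_gt0 sB _ e.
  by rewrite !reprK => ->.
- by move=> /inj0.
- by move=> /esym /inj0.
Qed.

(** The bonds of the suspension spectrum are identities, so level 0 forces all the other levels, and
    compatibility with the bonds holds by definition. *)
Fixpoint level_map n :
    ptmap (suspension_spectrum R (add_point (PU R k)) n) (Skl R k k n) :=
  if n is n'.+1 then
    Defs.pcomp (bond (Skl R k k) n') (susp_map R (level_map n'))
  else PU_eval.

Lemma susp_PU_compact n :
  compact [set: suspension_spectrum R (add_point (PU R k)) n].
Proof.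
elim: n => [|n IHn].
  by apply: add_point_compact; exact: PU_compact.
exact: (smash_compact IHn (@circle_compact R)).
Qed.

Lemma level_map_homeo n : (0 < k)%N ->
  exists g : ptmap (Skl R k k n) (suspension_spectrum R (add_point (PU R k)) n),
    cancel (level_map n) g /\ cancel g (level_map n).
Proof.
(* The inverse [g] is carried through the induction because its suspension inverts
   [susp_map R (level_map n)]; composing with the bijective assembly map then gives a bijection. *)
move=> k_gt0; elim: n => [|n [g [fK gK]]].
- apply: compact_hausdorff_homeo; first exact: (@susp_PU_compact 0).
  + exact: Gkl_hausdorff.
  + exact: PU_eval_inj.
  + exact: PU_eval_surj.
- apply: compact_hausdorff_homeo; first exact: (@susp_PU_compact n.+1).
  + exact: Gkl_hausdorff.
  + move=> z w zw; apply: (can_inj (susp_mapK fK)).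
    apply: (@assembly_inj R k (sphere R n) (circle R) k_gt0
      (@sphere_compact R n) (@sphere_C0_separates R n.+1)).
    exact: zw.
  + move=> psi.
    have [z <-] :=
      assembly_surj k_gt0 (@sphere_compact R n) (@circle_compact R) psi.
    exists (susp_map R g z).
    exact: (congr1 (bond (Skl R k k) n) (susp_mapK gK z)).
Qed.

Definition level_spectrum_map :
    spectrum_map (suspension_spectrum R (add_point (PU R k))) (Skl R k k) :=
  @SpectrumMap R _ _ level_map (fun n z => erefl).
End level_maps.

Theorem corollary1p5 (R : realType) (k : nat) (k_gt0 : (0 < k)%N) :
  spectrum_equivalent (Skl R k k)
    (suspension_spectrum R (add_point (PU R k))).
Proof.
(* The levelwise homeomorphism starts at the suspension spectrum, hence the reversal. *)
apply: rst_sym; apply: rst_step; exists (level_spectrum_map R k).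
pose g n := projT1 (cid (@level_map_homeo R k n k_gt0)).
have gP n : cancel (level_map R k n) (g n) /\ cancel (g n) (level_map R k n).
  exact: projT2 (cid (@level_map_homeo R k n k_gt0)).
by apply: (@levelwise_iso_stable_equivalence _ _ _ _ g) => n; have [] := gP n.
Qed.
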